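(* The system $\mathsf P$ proves that $\mathsf{STP}$ is equivalent to \[ (\forall T^1\le_11)\big[(\forall^{\mathrm{st}}n)(\exists\beta^0)(|\beta|=n\wedge\beta\in T)\to(\exists^{\mathrm{st}}\alpha^1\le_11)(\forall^{\mathrm{st}}n^0)(\overline\alpha n\in T)\big], \] and $\mathsf P$ also proves that $\mathsf{STP}$ is equivalent to \[ (\forall f^1)(\exists^{\mathrm{st}}g^1)\big((\forall^{\mathrm{st}}n^0)(\exists^{\mathrm{st}}m^0)(f(n)=m)\to f\approx_1g\big). \]
   Context: Framework. $\mathsf{E\text{-}PA}^{\omega*}$ is Peano arithmetic in all finite types with the axiom of extensionality, with additional types $\rho^*$ of finite sequences; type $0$ = naturals, $1=0\to0$. The language of $\mathsf P$ adds a predicate $\mathrm{st}$ (''standard'') for every type; $(\forall^{\mathrm{st}}x)\varphi\equiv(\forall x)(\mathrm{st}(x)\to\varphi)$, $(\exists^{\mathrm{st}}x)\varphi\equiv(\exists x)(\mathrm{st}(x)\wedge\varphi)$; internal = not containing $\mathrm{st}$. $\mathsf P$ is $\mathsf{E\text{-}PA}^{\omega*}$ plus: (i) $\mathrm{st}(x)\wedge x=y\to\mathrm{st}(y)$; (ii) $\mathrm{st}(t)$ for each closed term $t$ of $\mathsf{E\text{-}PA}^{\omega*}$; (iii) $\mathrm{st}(f)\wedge\mathrm{st}(x)\to\mathrm{st}(f(x))$; (iv) external induction $[\Phi(0)\wedge(\forall^{\mathrm{st}}n^0)(\Phi(n)\to\Phi(n+1))]\to(\forall^{\mathrm{st}}m^0)\Phi(m)$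 for every formula $\Phi$; (v) $\mathsf{HAC}_{\mathrm{int}}$: for internal $\varphi$, $(\forall^{\mathrm{st}}x^\rho)(\exists^{\mathrm{st}}y^\tau)\varphi(x,y)\to(\exists^{\mathrm{st}}F^{\rho\to\tau^*})(\forall^{\mathrm{st}}x^\rho)(\exists y\in F(x))\varphi(x,y)$; (vi) idealisation: for internal $\varphi$ with arbitrary parameters, $(\forall^{\mathrm{st}}x^{\sigma^*})(\exists y^\tau)(\forall z^\sigma\in x)\varphi(z,y)\to(\exists y^\tau)(\forall^{\mathrm{st}}x^\sigma)\varphi(x,y)$. $f\approx_1g$ means $(\forall^{\mathrm{st}}n^0)f(n)=g(n)$. Finite sequences of numbers are coded by numbers; $|\beta|$ is length; $\overline\alpha n$ is the initial segment of $\alpha$ of length $n$; $f\le_11$ means $(\forall n)f(n)\le1$; $T^1\le_11$ denotes that $T$ is a binary tree (a set of finite binary sequences given by its characteristic function). $\mathsf{STP}$: $(\forall f^1\le_11)(\exists^{\mathrm{st}}g^1\le_11)(f\approx_1g)$. *)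

(* Defs.v *)
From Stdlib Require Import List.
Import ListNotations.
Set Implicit Arguments.
Unset Strict Implicit.

(** * Syntax of the language of P *)

(** [N] is the type 0 and [Seq s] is the type s^*. *)
Inductive ty : Set :=
| N
| Arr (s t : ty)
| Seq (s : ty).
Notation "s ~> t" := (Arr s t) (at level 60, right associativity).

(** Goedel's T in combinator form, with lists.
    [cRec] and [cLRec] are the recursors on numbers and on sequences; see the
    axioms [ax_Rec0] to [ax_LRecC] for the order of the arguments. *)
Inductive const : ty -> Set :=
| cZero : const N
| cSucc : const (N ~> N)
| cK s t : const (s ~> t ~> s)
| cS r s t : const ((r ~> s ~> t) ~> (r ~> s) ~> r ~> t)
| cRec s : const (s ~> (s ~> N ~> s) ~> N ~> s)
| cNil s : const (Seq s)
| cCons s : const (s ~> Seq s ~> Seq s)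
| cLRec s t : const (t ~> (t ~> s ~> t) ~> Seq s ~> t).

(** Well-typed de Bruijn syntax: [V t] is the set of free variables of type
    [t], and [ext V s] adds one variable [v0] of type [s] to [V]. *)
Inductive ext (V : ty -> Set) (s : ty) : ty -> Set :=
| v0 : ext V s s
| vS t : V t -> ext V s t.
Arguments v0 {V s}.
Arguments vS {V s t} _.

Definition novar : ty -> Set := fun _ => Empty_set.

Inductive tm (V : ty -> Set) : ty -> Set :=
| Var t : V t -> tm V t
| Cst t : const t -> tm V t
| App s t : tm V (s ~> t) -> tm V s -> tm V t.
Arguments Var {V t} _.
Arguments Cst {V t} _.
Arguments App {V s t} _ _.

Inductive fm (V : ty -> Set) : Set :=
| Bot
| Eq s (a b : tm V s)
| St s (a : tm V s)
| Imp (p q : fm V)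
| And (p q : fm V)
| Or (p q : fm V)
| All s (p : fm (ext V s))
| Ex s (p : fm (ext V s)).
Arguments Bot {V}.
Arguments Eq {V s} _ _.
Arguments St {V s} _.
Arguments Imp {V} _ _.
Arguments And {V} _ _.
Arguments Or {V} _ _.
Arguments All {V} s _.
Arguments Ex {V} s _.

Notation "f $ a" := (App f a) (at level 45, left associativity).
Notation "a =o b" := (Eq a b) (at level 70, no associativity).
Notation "p /\o q" := (And p q) (at level 80, right associativity).
Notation "p \/o q" := (Or p q) (at level 85, right associativity).
Notation "p ->o q" := (Imp p q) (at level 99, right associativity).
Notation "p <->o q" := (And (Imp p q) (Imp q p)) (at level 95, no associativity).
Notation Neg p := (Imp p Bot).

Notation x0 := (Var v0).
Notation x1 := (Var (vS v0)).
Notation x2 := (Var (vS (vS v0))).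
Notation x3 := (Var (vS (vS (vS v0)))).
Notation x4 := (Var (vS (vS (vS (vS v0))))).

Fixpoint internal V (p : fm V) : bool :=
  match p with
  | Bot => true
  | Eq _ _ => true
  | St _ => false
  | Imp p q | And p q | Or p q => andb (internal p) (internal q)
  | All _ p | Ex _ p => internal p
  end.

Definition Allst V s (p : fm (ext V s)) : fm V := All s (St x0 ->o p).
Definition Exst V s (p : fm (ext V s)) : fm V := Ex s (St x0 /\o p).
Arguments Allst {V} s _.
Arguments Exst {V} s _.

(** ** Substitution *)

Definition sub (V W : ty -> Set) : Type := forall t, V t -> tm W t.

Fixpoint tsub V W (f : sub V W) t (a : tm V t) : tm W t :=
  match a with
  | Var x => f _ x
  | Cst c => Cst c
  | App a b => App (tsub f a) (tsub f b)
  end.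

Definition shift V s : sub V (ext V s) := fun t x => Var (vS x).
Arguments shift {V s} t _.

Definition twk V s t (a : tm V t) : tm (ext V s) t := tsub shift a.
Arguments twk {V s t} _.

(** Lifting of a substitution under a binder. *)
Definition up V W s (f : sub V W) : sub (ext V s) (ext W s) := fun t x =>
  match x in ext _ _ t return tm (ext W s) t with
  | v0 => x0
  | vS y => twk (f _ y)
  end.

Fixpoint fsub V (p : fm V) : forall W, sub V W -> fm W :=
  match p with
  | Bot => fun W f => Bot
  | Eq a b => fun W f => Eq (tsub f a) (tsub f b)
  | St a => fun W f => St (tsub f a)
  | Imp p q => fun W f => Imp (fsub p f) (fsub q f)
  | And p q => fun W f => And (fsub p f) (fsub q f)
  | Or p q => fun W f => Or (fsub p f) (fsub q f)
  | All s p => fun W f => All s (fsub p (up f))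
  | Ex s p => fun W f => Ex s (fsub p (up f))
  end.

Definition fwk V s (p : fm V) : fm (ext V s) := fsub p shift.
Arguments fwk {V s} _.

Definition scons V W s (a : tm W s) (f : sub V W) : sub (ext V s) W :=
  fun t x =>
  match x in ext _ _ t return tm W t with
  | v0 => a
  | vS y => f _ y
  end.

Definition inst V s (p : fm (ext V s)) (a : tm V s) : fm V :=
  fsub p (scons a (fun t x => Var x)).

Definition of_closed V t (a : tm novar t) : tm V t :=
  tsub (fun t (x : novar t) => match x with end) a.
Arguments of_closed {V t} _.

(** * Some terms and formulas of E-PA^{omega*} *)

(** Bracket abstraction: [lam a] is the combinator term "lambda x0. a". *)
Fixpoint lam V s t (a : tm (ext V s) t) : tm V (s ~> t) :=
  match a in tm _ t return tm V (s ~> t) with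
  | Var x =>
      match x in ext _ _ t return tm V (s ~> t) with
      | v0 => Cst (cS s (s ~> s) s) $ Cst (cK s (s ~> s)) $ Cst (cK s s)
      | vS y => Cst (cK _ s) $ Var y
      end
  | Cst c => Cst (cK _ s) $ Cst c
  | App f b => Cst (cS _ _ _) $ lam f $ lam b
  end.

Definition Zero {V} : tm V N := Cst cZero.
Definition Succ {V} (a : tm V N) : tm V N := Cst cSucc $ a.
Definition One {V} : tm V N := Succ Zero.

(** An arbitrary default element, for [nth] out of range. *)
Fixpoint default {V} (s : ty) : tm V s :=
  match s with
  | N => Zero
  | Arr s t => Cst (cK t s) $ default t
  | Seq s => Cst (cNil s)
  end.

Definition plus {V} (a b : tm V N) : tm V N :=
  Cst (cRec N) $ a $ lam (lam (Succ x1)) $ b.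

Definition Le {V} (a b : tm V N) : fm V := Ex N (plus (twk a) x0 =o twk b).
Definition Lt {V} (a b : tm V N) : fm V := Le (Succ a) b.

Definition len {V s} (l : tm V (Seq s)) : tm V N :=
  Cst (cLRec s N) $ Zero $ lam (lam (Succ x1)) $ l.

(** [nthf l] is the function mapping [i] to the [i]-th entry of [l]. *)
Definition nthf {V s} (l : tm V (Seq s)) : tm V (N ~> s) :=
  Cst (cLRec s (N ~> s))
    $ (Cst (cK s N) $ default s)
    $ lam (lam (lam (Cst (cRec s) $ x1 $ lam (lam (x4 $ x0)) $ x0)))
    $ l.

Definition Mem {V s} (a : tm V s) (l : tm V (Seq s)) : fm V :=
  Ex N (Lt x0 (len (twk l)) /\o nthf (twk l) $ x0 =o twk a).

(** [rcons l a] is the sequence [l] followed by the entry [a]. *)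
Definition rcons {V s} (l : tm V (Seq s)) (a : tm V s) : tm V (Seq s) :=
  Cst (cLRec s (Seq s))
    $ (Cst (cCons s) $ a $ Cst (cNil s))
    $ lam (lam (Cst (cCons s) $ x0 $ x1))
    $ l.

(** The sequence < f(0), ..., f(n-1) >. *)
Definition initseg {V s} (f : tm V (N ~> s)) (n : tm V N) : tm V (Seq s) :=
  Cst (cRec (Seq s))
    $ Cst (cNil s)
    $ (lam (lam (lam (rcons x1 (x2 $ x0)))) $ f)
    $ n.

(** Cantor pairing: [pair a b] = (0 + 1 + ... + (a + b)) + a. *)
Definition triangle {V} (n : tm V N) : tm V N :=
  Cst (cRec N) $ Zero $ lam (lam (plus x1 (Succ x0))) $ n.
Definition pair {V} (a b : tm V N) : tm V N := plus (triangle (plus a b)) a.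

(** Coding of finite sequences of numbers by numbers, a bijection:
    the code of <> is 0, that of <a> * l is 1 + pair a (code l). *)
Definition code {V} (l : tm V (Seq N)) : tm V N :=
  Cst (cLRec N N) $ Zero $ lam (lam (Succ (pair x0 x1))) $ l.

(** |b| = n, where [b] : 0 is the code of a finite sequence. *)
Definition HasLength {V} (b n : tm V N) : fm V :=
  Ex (Seq N) (code x0 =o twk b /\o len x0 =o twk n).

(** The code of the initial segment of [f] of length [n]. *)
Definition bar {V} (f : tm V (N ~> N)) (n : tm V N) : tm V N :=
  code (initseg f n).

(** * The systems *)

(** Classical many-sorted natural deduction over a set [ax] of axioms. *)
Inductive derivable (ax : forall V, fm V -> Prop) (V : ty -> Set)
    (H : list (fm V)) : fm V -> Prop :=
| d_hyp p : In p H -> derivable ax H p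
| d_ax p : ax V p -> derivable ax H p
| d_impI p q : derivable ax (p :: H) q -> derivable ax H (p ->o q)
| d_impE p q : derivable ax H (p ->o q) -> derivable ax H p -> derivable ax H q
| d_andI p q : derivable ax H p -> derivable ax H q -> derivable ax H (p /\o q)
| d_andE1 p q : derivable ax H (p /\o q) -> derivable ax H p
| d_andE2 p q : derivable ax H (p /\o q) -> derivable ax H q
| d_orI1 p q : derivable ax H p -> derivable ax H (p \/o q)
| d_orI2 p q : derivable ax H q -> derivable ax H (p \/o q)
| d_orE p q r : derivable ax H (p \/o q) ->
    derivable ax (p :: H) r -> derivable ax (q :: H) r -> derivable ax H r
| d_raa p : derivable ax (Neg p :: H) Bot -> derivable ax H p
| d_allI s (p : fm (ext V s)) :
    derivable ax (map fwk H) p -> derivable ax H (All s p)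
| d_allE s (p : fm (ext V s)) a :
    derivable ax H (All s p) -> derivable ax H (inst p a)
| d_exI s (p : fm (ext V s)) a :
    derivable ax H (inst p a) -> derivable ax H (Ex s p)
| d_exE s (p : fm (ext V s)) q : derivable ax H (Ex s p) ->
    derivable ax (p :: map fwk H) (fwk q) -> derivable ax H q.

(** [at_succ p] is p(x0 + 1), still with the free variable x0. *)
Definition at_succ {V} (p : fm (ext V N)) : fm (ext V N) :=
  fsub p (scons (Succ x0) shift).

(** E-PA^{omega*}, with equality primitive at every type.  Every axiom may
    contain free variables, so all schemata admit arbitrary parameters. *)
Inductive ax_EPA (V : ty -> Set) : fm V -> Prop :=
| ax_refl s (a : tm V s) : ax_EPA (a =o a)
| ax_leibniz s (p : fm (ext V s)) a b : internal p = true ->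
    ax_EPA (a =o b ->o inst p a ->o inst p b)
| ax_ext s t (f g : tm V (s ~> t)) :
    ax_EPA (All s (twk f $ x0 =o twk g $ x0) ->o f =o g)
| ax_succ0 (a : tm V N) : ax_EPA (Neg (Succ a =o Zero))
| ax_succ_inj (a b : tm V N) : ax_EPA (Succ a =o Succ b ->o a =o b)
| ax_ind (p : fm (ext V N)) : internal p = true ->
    ax_EPA (inst p Zero /\o All N (p ->o at_succ p) ->o All N p)
| ax_K s t (a : tm V s) (b : tm V t) : ax_EPA (Cst (cK s t) $ a $ b =o a)
| ax_S r s t (a : tm V (r ~> s ~> t)) b c :
    ax_EPA (Cst (cS r s t) $ a $ b $ c =o a $ c $ (b $ c))
| ax_Rec0 s (a : tm V s) f : ax_EPA (Cst (cRec s) $ a $ f $ Zero =o a)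
| ax_RecS s (a : tm V s) f n :
    ax_EPA (Cst (cRec s) $ a $ f $ Succ n
            =o f $ (Cst (cRec s) $ a $ f $ n) $ n)
| ax_LRec0 s t (a : tm V t) f :
    ax_EPA (Cst (cLRec s t) $ a $ f $ Cst (cNil s) =o a)
| ax_LRecC s t (a : tm V t) f (b : tm V s) l :
    ax_EPA (Cst (cLRec s t) $ a $ f $ (Cst (cCons s) $ b $ l)
            =o f $ (Cst (cLRec s t) $ a $ f $ l) $ b)
| ax_SA s (l : tm V (Seq s)) :
    ax_EPA (l =o Cst (cNil s)
            \/o Ex s (Ex (Seq s) (twk (twk l) =o Cst (cCons s) $ x1 $ x0))).

Inductive ax_P (V : ty -> Set) : fm V -> Prop :=
| ax_int p : ax_EPA p -> ax_P p
| ax_st_eq s (a b : tm V s) : ax_P (St a /\o a =o b ->o St b)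
| ax_st_closed s (a : tm novar s) : ax_P (St (of_closed a))
| ax_st_app s t (f : tm V (s ~> t)) a : ax_P (St f /\o St a ->o St (f $ a))
| ax_ext_ind (p : fm (ext V N)) :
    ax_P (inst p Zero /\o Allst N (p ->o at_succ p) ->o Allst N p)
(** HAC_int for p(x, y), where y = x0 and x = x1. *)
| ax_HAC r t (p : fm (ext (ext V r) t)) : internal p = true ->
    ax_P (Allst r (Exst t p) ->o
          Exst (r ~> Seq t)
            (Allst r (Ex t (Mem x0 (x2 $ x1) /\o fsub p (up (up shift))))))
(** Idealisation for p(z, y), where z = x0 and y = x1. *)
| ax_I s t (p : fm (ext (ext V t) s)) : internal p = true ->
    ax_P (Allst (Seq s) (Ex t (All s (Mem x0 x2 ->o fsub p (up (up shift)))))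
          ->o Ex t (Allst s p)).

Definition P_proves (p : fm novar) : Prop := derivable ax_P [] p.

(** * The principles *)

(** f <=_1 1 *)
Definition Le1 {V} (f : tm V (N ~> N)) : fm V := All N (Le (twk f $ x0) One).

(** f ~~_1 g *)
Definition approx {V} (f g : tm V (N ~> N)) : fm V :=
  Allst N (twk f $ x0 =o twk g $ x0).

(** Membership of [b] in the set with characteristic function [T]. *)
Definition InSet {V} (b : tm V N) (T : tm V (N ~> N)) : fm V := T $ b =o One.

(** [T] is a binary tree: a characteristic function of a set of codes of finite
    0-1 sequences which is closed under initial segments. *)
Definition BinTree {V} (T : tm V (N ~> N)) : fm V :=
  Le1 T
  /\o All N (InSet x0 (twk T) ->o
        Ex (Seq N) (code x0 =o x1
                    /\o All N (Lt x0 (len x1) ->o Le (nthf x1 $ x0) One)))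
  /\o All (Seq N) (All N
        (Le x0 (len x1) /\o InSet (code x1) (twk (twk T)) ->o
         InSet (bar (nthf x1) x0) (twk (twk T)))).

Definition STP : fm novar :=
  All (N ~> N) (Le1 x0 ->o Exst (N ~> N) (Le1 x0 /\o approx x1 x0)).

Definition STP_tree : fm novar :=
  All (N ~> N) (BinTree x0 ->o
    Allst N (Ex N (HasLength x0 x1 /\o InSet x0 x2)) ->o
    Exst (N ~> N) (Le1 x0 /\o Allst N (InSet (bar x1 x0) x2))).

Definition STP_fun : fm novar :=
  All (N ~> N) (Exst (N ~> N)
    (Allst N (Exst N (x3 $ x1 =o x0)) ->o approx x1 x0)).

(* Main.v *)
(** P is complete for its many-sorted models in which [=o] is equality (Henkin's
    construction), so it suffices to argue inside an arbitrary model.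

    STP gives a path through a tree because idealisation yields a node of
    nonstandard length, whose standard part is a path.  Conversely, a path
    through the tree of initial segments of [f] is a standard part of [f].
    For the last principle, STP applied to the graph of [f], coded as a 0-1
    function, gives a standard graph from which HAC_int and a search through
    finite sequences extract a standard [g]; conversely, the standard function
    obtained from a 0-1 function is truncated at 1. *)

(* Passing to models replaces formal derivations by work in a possibly nonstandard arithmetic. The
   domain of type 0 need not be [nat], so even commutativity of addition has to come from the
   model's own induction axiom, applied to a formula written out as syntax with elements of the
   model as free variables.

   In the implications themselves the delicate point is standardness. The tree or graph built from
   [f] is in general as nonstandard as [f]; only the assumed principle yields a standard object.
   Whatever is built from it afterwards must be a closed term applied to standard arguments. This is
   why truncation and search are given as explicit terms of the language. A search is called for
   because HAC_int supplies only a finite sequence of candidates at each argument.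

   Trees and graphs are ranges of functions [h]. Their characteristic functions are computed by
   bounded search, which is possible because each [h] used satisfies k <= h(k): a code bounds the
   length of its sequence, and a pair bounds its first component. *)
From Stdlib Require Import List Arith Lia Eqdep_dec Cantor.
From Stdlib Require Import ClassicalEpsilon FunctionalExtensionality.
From Stdlib Require Import PropExtensionality ProofIrrelevance.
Require Import Defs.
Import ListNotations.
Set Implicit Arguments.
Unset Strict Implicit.

(** * Substitution calculus *)

(** The target family [X] is arbitrary, so that the lemma serves both substitutions, with terms as
    values, and environments, with elements of a model as values. *)
Lemma ext_eq (V : ty -> Set) s (X : ty -> Type)
    (f g : forall t, ext V s t -> X t) :
  f s v0 = g s v0 -> (forall t (x : V t), f t (vS x) = g t (vS x)) -> f = g.
Proof.
  intros H0 HS. apply functional_extensionality_dep; intros t.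
  apply functional_extensionality_dep; intros x. destruct x; auto.
Qed.

Lemma sub_eq (V W : ty -> Set) (f g : sub V W) :
  (forall t x, f t x = g t x) -> f = g.
Proof.
  intros H. apply functional_extensionality_dep; intros t.
  apply functional_extensionality_dep; intros x. apply H.
Qed.

Definition idsub V : sub V V := fun t x => Var x.
Arguments idsub {V} t _.

Definition sub_comp V W X (g : sub W X) (f : sub V W) : sub V X :=
  fun t x => tsub g (f t x).

Lemma tsub_id V t (a : tm V t) : tsub idsub a = a.
Proof. induction a; simpl; rewrite ?IHa1, ?IHa2; reflexivity. Qed.

Lemma tsub_tsub V W X (f : sub V W) (g : sub W X) t (a : tm V t) :
  tsub g (tsub f a) = tsub (sub_comp g f) a.
Proof. induction a; simpl; rewrite ?IHa1, ?IHa2; reflexivity. Qed.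

Lemma tsub_twk_up V W s (f : sub V W) t (a : tm V t) :
  tsub (up f) (@twk V s t a) = twk (tsub f a).
Proof. unfold twk. now rewrite !tsub_tsub. Qed.

Lemma tsub_twk_scons V W s (f : sub V W) (b : tm W s) t (a : tm V t) :
  tsub (scons b f) (twk a) = tsub f a.
Proof. unfold twk. now rewrite tsub_tsub. Qed.

Lemma up_comp V W X s (f : sub V W) (g : sub W X) :
  sub_comp (@up _ _ s g) (up f) = up (sub_comp g f).
Proof.
  apply ext_eq; [reflexivity|]. intros t x.
  apply tsub_twk_up.
Qed.

Lemma up_id V s : @up V V s idsub = idsub.
Proof. now apply ext_eq. Qed.

Lemma fsub_id V (p : fm V) : fsub p idsub = p.
Proof.
  induction p; simpl; rewrite ?up_id, ?tsub_id, ?IHp, ?IHp1, ?IHp2; reflexivity.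
Qed.

Lemma fsub_fsub V (p : fm V) : forall W X (f : sub V W) (g : sub W X),
  fsub (fsub p f) g = fsub p (sub_comp g f).
Proof.
  induction p; intros W X f g; simpl; rewrite ?tsub_tsub; f_equal; auto;
    now rewrite IHp, up_comp.
Qed.

Lemma sub_comp_scons_up V W X s (f : sub V W) (g : sub W X) (a : tm X s) :
  sub_comp (scons a g) (up f) = scons a (sub_comp g f).
Proof.
  apply ext_eq; [reflexivity|]. intros t x. apply tsub_twk_scons.
Qed.

Lemma sub_comp_id_l V W (f : sub V W) : sub_comp idsub f = f.
Proof. apply sub_eq; intros. apply tsub_id. Qed.

Lemma inst_fsub_up V W s (p : fm (ext V s)) (f : sub V W) (a : tm W s) :
  inst (fsub p (up f)) a = fsub p (scons a f).
Proof.
  unfold inst. rewrite fsub_fsub.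
  change (fun t x => Var x) with (@idsub W).
  now rewrite sub_comp_scons_up, sub_comp_id_l.
Qed.

Lemma fsub_inst V W s (p : fm (ext V s)) (a : tm V s) (f : sub V W) :
  fsub (inst p a) f = inst (fsub p (up f)) (tsub f a).
Proof.
  rewrite inst_fsub_up. unfold inst. rewrite fsub_fsub. f_equal.
  now apply ext_eq.
Qed.

Lemma fsub_fwk_up V W s (p : fm V) (f : sub V W) :
  fsub (fwk p) (@up _ _ s f) = fwk (fsub p f).
Proof. unfold fwk. now rewrite !fsub_fsub. Qed.

Lemma inst_up_shift V s (p : fm (ext V s)) : inst (fsub p (up shift)) x0 = p.
Proof.
  rewrite inst_fsub_up. rewrite <- (fsub_id p) at 2. f_equal.
  now apply ext_eq.
Qed.

Lemma fsub_at_succ V W (p : fm (ext V N)) (f : sub V W) :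
  fsub (at_succ p) (up f) = at_succ (fsub p (up f)).
Proof.
  unfold at_succ. rewrite !fsub_fsub. f_equal. apply ext_eq; [reflexivity|].
  intros t x. symmetry. apply tsub_twk_scons.
Qed.

Lemma internal_fsub V (p : fm V) : forall W (f : sub V W),
  internal (fsub p f) = internal p.
Proof. induction p; intros; simpl; rewrite ?IHp1, ?IHp2; auto. Qed.

Lemma tsub_default V W (f : sub V W) s : tsub f (default s) = default s.
Proof. induction s; simpl; rewrite ?IHs2; reflexivity. Qed.

Lemma fsub_Le V W (a b : tm V N) (f : sub V W) :
  fsub (Le a b) f = Le (tsub f a) (tsub f b).
Proof. unfold Le. cbn [fsub]. now rewrite <- !tsub_twk_up. Qed.

Lemma tsub_nthf V W s (l : tm V (Seq s)) (f : sub V W) :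
  tsub f (nthf l) = nthf (tsub f l).
Proof. unfold nthf. cbn [tsub]. rewrite tsub_default. reflexivity. Qed.

Lemma fsub_Mem V W s (a : tm V s) (l : tm V (Seq s)) (f : sub V W) :
  fsub (Mem a l) f = Mem (tsub f a) (tsub f l).
Proof.
  unfold Mem, Lt. cbn [fsub tsub].
  rewrite fsub_Le, tsub_nthf, !tsub_twk_up.
  change (tsub (up f) (len (twk l))) with (len (tsub (up f) (@twk _ N _ l))).
  now rewrite tsub_twk_up.
Qed.

(** * Stability of the system under substitution *)

Lemma ax_EPA_sub V W (p : fm V) (f : sub V W) : ax_EPA p -> ax_EPA (fsub p f).
Proof.
  intros H; destruct H; simpl; rewrite ?fsub_inst, ?fsub_at_succ, ?tsub_twk_up;
    constructor; now rewrite ?internal_fsub.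
Qed.

(** In HAC_int and in idealisation the conclusion or premise inserts one more bound variable outside
    the two variables of the matrix [p]. An instance of either scheme stays an instance under
    substitution because this insertion commutes with substituting. *)
Lemma fsub_up2_shift V W r s t (p : fm (ext (ext V r) t)) (f : sub V W) :
  fsub (fsub p (up (up (@shift V s)))) (up (up (up f)))
  = fsub (fsub p (up (up f))) (up (up shift)).
Proof.
  rewrite !fsub_fsub, !up_comp. reflexivity.
Qed.

Lemma ax_P_sub V W (p : fm V) (f : sub V W) : ax_P p -> ax_P (fsub p f).
Proof.
  intros H; destruct H; unfold Allst, Exst; cbn [fsub tsub].
  - now apply ax_int, ax_EPA_sub.
  - apply ax_st_eq.
  - unfold of_closed. rewrite tsub_tsub.
    replace (sub_comp f _)
      with (fun t (x : novar t) => match x return tm W t with end)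
      by (apply sub_eq; intros ? []).
    apply ax_st_closed.
  - apply ax_st_app.
  - rewrite fsub_inst, fsub_at_succ. apply ax_ext_ind.
  - rewrite fsub_Mem, fsub_up2_shift. apply (@ax_HAC W r t).
    now rewrite internal_fsub.
  - rewrite fsub_Mem, fsub_up2_shift. apply (@ax_I W s t).
    now rewrite internal_fsub.
Qed.

(** Needed for two substitutions: the renaming that turns a fresh variable into a bound one, and the
    replacement of all free variables by closed terms that ends the completeness proof. *)
Lemma derivable_sub V (H : list (fm V)) p : derivable ax_P H p ->
  forall W (f : sub V W), derivable ax_P (map (fun q => fsub q f) H) (fsub p f).
Proof.
  assert (E : forall V (H : list (fm V)) s W (f : sub V W),
    map (fun q => fsub q (@up _ _ s f)) (map fwk H)
    = map fwk (map (fun q => fsub q f) H)).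
  { intros. rewrite !map_map. apply map_ext. intros; apply fsub_fwk_up. }
  induction 1; intros W f; simpl in *.
  - apply d_hyp. now apply (in_map (fun q => fsub q f)).
  - now apply d_ax, ax_P_sub.
  - apply d_impI; auto.
  - eapply d_impE; eauto.
  - apply d_andI; auto.
  - eapply d_andE1; eauto.
  - eapply d_andE2; eauto.
  - apply d_orI1; auto.
  - apply d_orI2; auto.
  - eapply d_orE; eauto.
  - apply d_raa; auto.
  - apply d_allI. rewrite <- E. auto.
  - rewrite fsub_inst. apply d_allE. apply (IHderivable W f).
  - apply d_exI with (a := tsub f a). rewrite <- fsub_inst. auto.
  - eapply d_exE; [apply (IHderivable1 W f)|].
    rewrite <- E, <- fsub_fwk_up. apply (IHderivable2 _ (up f)).
Qed.

Lemma derivable_weaken V (H H' : list (fm V)) p :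
  derivable ax_P H p -> incl H H' -> derivable ax_P H' p.
Proof.
  intros D; revert H'; induction D; intros H' I.
  - apply d_hyp; auto.
  - now apply d_ax.
  - apply d_impI, IHD, incl_cons; [now left | now apply incl_tl].
  - eapply d_impE; eauto.
  - apply d_andI; auto.
  - eapply d_andE1; eauto.
  - eapply d_andE2; eauto.
  - apply d_orI1; auto.
  - apply d_orI2; auto.
  - eapply d_orE; [eauto|apply IHD2|apply IHD3];
      (apply incl_cons; [now left | now apply incl_tl]).
  - apply d_raa, IHD, incl_cons; [now left | now apply incl_tl].
  - apply d_allI, IHD, incl_map, I.
  - apply d_allE; auto.
  - eapply d_exI; eauto.
  - eapply d_exE; [eauto|]. apply IHD2.
    apply incl_cons; [now left | now apply incl_tl, incl_map].
Qed.

(** * Enumeration of the formulas *)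

Lemma ty_eq_dec (s t : ty) : {s = t} + {s <> t}.
Proof. decide equality. Defined.

Lemma ty_eq_dec_refl s : ty_eq_dec s s = left eq_refl.
Proof.
  destruct (ty_eq_dec s s) as [e|n]; [|congruence].
  f_equal. apply UIP_dec, ty_eq_dec.
Qed.

(** Syntax is enumerated by decoding it from binary trees with total functions. Only surjectivity is
    required, so ill-formed trees may decode to anything and no injective coding of dependently
    typed syntax is needed. *)
Inductive tree : Set := L | B (a b : tree).

Fixpoint trees n : list tree :=
  match n with
  | 0 => [L]
  | S n => L :: flat_map (fun a => map (B a) (trees n)) (trees n)
  end.

Lemma trees_mono n a : In a (trees n) -> In a (trees (S n)).
Proof.
  revert a; induction n as [|n IH]; intros a.
  - simpl. intros [<-|[]]. now left.
  - intros [<-|H]; [now left|]. right.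
    apply in_flat_map in H as (b & Hb & H).
    apply in_map_iff in H as (c & <- & Hc).
    apply in_flat_map. exists b. split; [now apply IH|].
    apply in_map. now apply IH.
Qed.

Lemma trees_exhaust a : exists n, In a (trees n).
Proof.
  assert (M : forall n m a, n <= m -> In a (trees n) -> In a (trees m)).
  { intros n m b H. induction H; auto using trees_mono. }
  induction a as [|a [n Hn] b [m Hm]].
  - exists 0. now left.
  - exists (S (max n m)). right. apply in_flat_map.
    exists a; split; [apply (M n); auto; lia|].
    apply in_map. apply (M m); auto; lia.
Qed.

Definition nat_tree (n : nat) : tree :=
  let (k, i) := of_nat n in nth i (trees k) L.

Lemma nat_tree_surj a : exists n, nat_tree n = a.
Proof.
  destruct (trees_exhaust a) as [k Hk].
  destruct (In_nth _ _ L Hk) as (i & _ & Hi).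
  exists (to_nat (k, i)). unfold nat_tree. now rewrite cancel_of_to.
Qed.

Fixpoint dec_nat (a : tree) : nat :=
  match a with L => 0 | B _ a => S (dec_nat a) end.

Lemma dec_nat_surj n : exists a, dec_nat a = n.
Proof.
  induction n as [|n [a <-]]; [now exists L|now exists (B L a)].
Qed.

Fixpoint dec_ty (a : tree) : ty :=
  match a with
  | L => N
  | B L a => Seq (dec_ty a)
  | B (B a b) _ => dec_ty a ~> dec_ty b
  end.

Lemma dec_ty_surj s : exists a, dec_ty a = s.
Proof.
  induction s as [|s [a <-] t [b <-]|s [a <-]].
  - now exists L.
  - now exists (B (B a b) L).
  - now exists (B L a).
Qed.

Definition some_const t (c : const t) : {t & const t} := existT _ t c.

Definition dec_const (a : tree) : {t & const t} :=
  match a with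
  | B n (B r (B s t)) =>
    let r := dec_ty r in let s := dec_ty s in let t := dec_ty t in
    match dec_nat n with
    | 0 => some_const cZero
    | 1 => some_const cSucc
    | 2 => some_const (cK r s)
    | 3 => some_const (cS r s t)
    | 4 => some_const (cRec r)
    | 5 => some_const (cNil r)
    | 6 => some_const (cCons r)
    | _ => some_const (cLRec r s)
    end
  | _ => some_const cZero
  end.

Lemma dec_const_surj t (c : const t) : exists a, dec_const a = some_const c.
Proof.
  assert (E : forall n r s t, exists k a b c,
    dec_nat k = n /\ dec_ty a = r /\ dec_ty b = s /\ dec_ty c = t).
  { intros n r s u. destruct (dec_nat_surj n) as [x Hx].
    destruct (dec_ty_surj r) as [y Hy], (dec_ty_surj s) as [z Hz],
      (dec_ty_surj u) as [w Hw]. now exists x, y, z, w. }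
  destruct c;
    [ destruct (E 0 N N N) as (k & x & y & z & Hk & Hx & Hy & Hz)
    | destruct (E 1 N N N) as (k & x & y & z & Hk & Hx & Hy & Hz)
    | destruct (E 2 s t N) as (k & x & y & z & Hk & Hx & Hy & Hz)
    | destruct (E 3 r s t) as (k & x & y & z & Hk & Hx & Hy & Hz)
    | destruct (E 4 s N N) as (k & x & y & z & Hk & Hx & Hy & Hz)
    | destruct (E 5 s N N) as (k & x & y & z & Hk & Hx & Hy & Hz)
    | destruct (E 6 s N N) as (k & x & y & z & Hk & Hx & Hy & Hz)
    | destruct (E 7 s t N) as (k & x & y & z & Hk & Hx & Hy & Hz) ];
    exists (B k (B x (B y z))); simpl; rewrite Hk, ?Hx, ?Hy, ?Hz; reflexivity.
Qed.

(** Decoding is relative to the family of variables, since it changes under a binder. The result is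
    optional because a family may have no variable at all. *)
Definition var_decoder (V : ty -> Set) := tree -> option {t & V t}.

Definition surj_decoder V (d : var_decoder V) :=
  forall t (x : V t), exists a, d a = Some (existT _ t x).

Definition dec_ext V s (d : var_decoder V) : var_decoder (ext V s) := fun a =>
  match a with
  | L => Some (existT _ s v0)
  | B a _ => match d a with
             | Some (existT _ t x) => Some (existT _ t (vS x))
             | None => None
             end
  end.

Lemma dec_ext_surj V s (d : var_decoder V) :
  surj_decoder d -> surj_decoder (@dec_ext V s d).
Proof.
  intros H t x. destruct x as [|t x].
  - now exists L.
  - destruct (H t x) as [a Ha]. exists (B a L). simpl. now rewrite Ha.
Qed.

Definition some_tm V t (a : tm V t) : option {t & tm V t} :=
  Some (existT _ t a).

Definition mk_app V s t (f : tm V s) (a : tm V t) : option {t & tm V t} :=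
  match s as s return tm V s -> option {t & tm V t} with
  | Arr s1 s2 => fun f =>
      match ty_eq_dec t s1 with
      | left e => some_tm (f $ eq_rect t (tm V) a s1 e)
      | right _ => None
      end
  | _ => fun _ => None
  end f.

Fixpoint dec_tm V (d : var_decoder V) (a : tree) : option {t & tm V t} :=
  match a with
  | B L a => match d a with
             | Some (existT _ t x) => some_tm (Var x)
             | None => None
             end
  | B (B a b) L =>
      match dec_tm d a, dec_tm d b with
      | Some (existT _ s f), Some (existT _ t x) => mk_app f x
      | _, _ => None
      end
  | B (B a _) (B _ _) => let (t, c) := dec_const a in some_tm (Cst c)
  | L => None
  end.

Lemma dec_tm_surj V (d : var_decoder V) (Hd : surj_decoder d) t (a : tm V t) :
  exists c, dec_tm d c = some_tm a.
Proof.
  induction a as [t x|t c|s t f [c1 H1] a [c2 H2]].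
  - destruct (Hd t x) as [a Ha]. exists (B L a). simpl. now rewrite Ha.
  - destruct (dec_const_surj c) as [a Ha].
    exists (B (B a L) (B L L)). simpl. now rewrite Ha.
  - exists (B (B c1 c2) L). simpl. rewrite H1, H2. simpl.
    now rewrite ty_eq_dec_refl.
Qed.

Definition mk_eq V s t (a : tm V s) (b : tm V t) : fm V :=
  match ty_eq_dec s t with
  | left e => eq_rect s (tm V) a t e =o b
  | right _ => Bot
  end.

Fixpoint dec_fm (c : tree) : forall V, var_decoder V -> fm V :=
  match c with
  | L => fun V d => Bot
  | B k (B a b) => fun V d =>
      match dec_nat k with
      | 0 => match dec_tm d a, dec_tm d b with
             | Some (existT _ s a), Some (existT _ t b) => mk_eq a b
             | _, _ => Bot
             end
      | 1 => match dec_tm d a with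
             | Some (existT _ s a) => St a
             | _ => Bot
             end
      | 2 => dec_fm a d ->o dec_fm b d
      | 3 => dec_fm a d /\o dec_fm b d
      | 4 => dec_fm a d \/o dec_fm b d
      | 5 => All (dec_ty a) (dec_fm b (dec_ext _ d))
      | _ => Ex (dec_ty a) (dec_fm b (dec_ext _ d))
      end
  | B _ L => fun V d => Bot
  end.

Lemma dec_fm_surj V (p : fm V) : forall (d : var_decoder V),
  surj_decoder d -> exists c, dec_fm c d = p.
Proof.
  assert (K : forall k, exists a, dec_nat a = k) by apply dec_nat_surj.
  induction p as [V|V s a b|V s a|V p IHp q IHq|V p IHp q IHq|V p IHp q IHq
    |V s p IHp|V s p IHp]; intros d Hd.
  - now exists L.
  - destruct (K 0) as [k Hk], (dec_tm_surj Hd a) as [x Hx],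
      (dec_tm_surj Hd b) as [y Hy].
    exists (B k (B x y)). simpl. rewrite Hk, Hx, Hy. unfold mk_eq; simpl.
    now rewrite ty_eq_dec_refl.
  - destruct (K 1) as [k Hk], (dec_tm_surj Hd a) as [x Hx].
    exists (B k (B x L)). simpl. now rewrite Hk, Hx.
  - destruct (K 2) as [k Hk], (IHp d Hd) as [x Hx], (IHq d Hd) as [y Hy].
    exists (B k (B x y)). simpl. now rewrite Hk, Hx, Hy.
  - destruct (K 3) as [k Hk], (IHp d Hd) as [x Hx], (IHq d Hd) as [y Hy].
    exists (B k (B x y)). simpl. now rewrite Hk, Hx, Hy.
  - destruct (K 4) as [k Hk], (IHp d Hd) as [x Hx], (IHq d Hd) as [y Hy].
    exists (B k (B x y)). simpl. now rewrite Hk, Hx, Hy.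
  - destruct (K 5) as [k Hk], (dec_ty_surj s) as [x <-],
      (IHp _ (@dec_ext_surj _ _ _ Hd)) as [y Hy].
    exists (B k (B x y)). simpl. now rewrite Hk, Hy.
  - destruct (K 6) as [k Hk], (dec_ty_surj s) as [x <-],
      (IHp _ (@dec_ext_surj _ _ _ Hd)) as [y Hy].
    exists (B k (B x y)). simpl. now rewrite Hk, Hy.
Qed.

(** Infinitely many variables at each type, so that Henkin witnesses can be variables and the
    language never has to be extended by constants. *)
Definition natvar : ty -> Set := fun _ => nat.

Definition enum_fm (n : nat) : fm natvar :=
  dec_fm (nat_tree n) (fun a =>
    match a with
    | L => None
    | B a b => Some (existT natvar (dec_ty a) (dec_nat b))
    end).

Lemma enum_fm_surj (p : fm natvar) : exists n, enum_fm n = p.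
Proof.
  edestruct (@dec_fm_surj natvar p) as [c Hc]; cycle 1.
  - destruct (nat_tree_surj c) as [n Hn]. exists n. unfold enum_fm.
    rewrite Hn. exact Hc.
  - intros t x. destruct (dec_ty_surj t) as [a <-], (dec_nat_surj x) as [b <-].
    now exists (B a b).
Qed.

(** * Fresh variables *)

(** Capture of the [m]-th variable of type [s]: this renaming agrees with
    [shift] on a formula exactly when that variable is fresh for it. *)
Definition capture s (m : nat) : sub natvar (ext natvar s) := fun t x =>
  match ty_eq_dec s t with
  | left e => if Nat.eqb x m then Var (eq_rect s (ext natvar s) v0 t e)
              else Var (vS x)
  | right _ => Var (vS x)
  end.

Lemma capture_self s m : capture s m (m : natvar s) = x0.
Proof. unfold capture. now rewrite ty_eq_dec_refl, Nat.eqb_refl. Qed.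

(** Stands in for a definition of free variables: a variable counts as fresh when its index is large
    enough, and such conditions combine under finite conjunction. *)
Definition eventually (Q : nat -> Prop) := exists n, forall m, n <= m -> Q m.

Lemma eventually_and Q R :
  eventually Q -> eventually R -> eventually (fun m => Q m /\ R m).
Proof.
  intros [n Hn] [k Hk]. exists (max n k). intros m Hm.
  split; [apply Hn|apply Hk]; lia.
Qed.

Lemma eventually_impl (Q R : nat -> Prop) :
  (forall m, Q m -> R m) -> eventually Q -> eventually R.
Proof. intros H [n Hn]. exists n; auto. Qed.

Lemma tsub_eventually V W (f : nat -> sub V W) (g : sub V W) :
  (forall t x, eventually (fun m => f m t x = g t x)) ->
  forall t (a : tm V t), eventually (fun m => tsub (f m) a = tsub g a).
Proof.
  intros H t a. induction a as [t x|t c|s t a IHa b IHb]; simpl.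
  - apply H.
  - now exists 0.
  - apply (eventually_impl (Q := fun m => tsub (f m) a = tsub g a
      /\ tsub (f m) b = tsub g b)); [intros m [-> ->]; reflexivity|].
    now apply eventually_and.
Qed.

(** Pointwise eventual agreement becomes agreement on a whole formula because a formula has only
    finitely many occurrences of variables, each contributing one bound. *)
Lemma fsub_eventually V (p : fm V) : forall W (f : nat -> sub V W) (g : sub V W),
  (forall t x, eventually (fun m => f m t x = g t x)) ->
  eventually (fun m => fsub p (f m) = fsub p g).
Proof.
  assert (U : forall V W (f : nat -> sub V W) (g : sub V W) s,
    (forall t x, eventually (fun m => f m t x = g t x)) ->
    forall t (x : ext V s t), eventually (fun m => up (f m) x = up g x)).
  { intros X W f g s H t x. destruct x as [|t x]; [now exists 0|].
    eapply eventually_impl; [|apply (H t x)]. simpl. intros m ->; reflexivity. }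
  induction p as [V|V s a b|V s a|V p IHp q IHq|V p IHp q IHq|V p IHp q IHq
    |V s p IHp|V s p IHp]; intros W f g H; simpl.
  - now exists 0.
  - eapply eventually_impl;
      [|exact (eventually_and (tsub_eventually H a) (tsub_eventually H b))].
    simpl; intros m [-> ->]; reflexivity.
  - eapply eventually_impl; [|exact (tsub_eventually H a)].
    simpl; intros m ->; reflexivity.
  - eapply eventually_impl; [|exact (eventually_and (IHp _ _ _ H) (IHq _ _ _ H))].
    simpl; intros m [-> ->]; reflexivity.
  - eapply eventually_impl; [|exact (eventually_and (IHp _ _ _ H) (IHq _ _ _ H))].
    simpl; intros m [-> ->]; reflexivity.
  - eapply eventually_impl; [|exact (eventually_and (IHp _ _ _ H) (IHq _ _ _ H))].
    simpl; intros m [-> ->]; reflexivity.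
  - eapply eventually_impl; [|exact (IHp _ _ _ (U _ _ _ _ s H))].
    simpl; intros m E; exact (f_equal (@All W s) E).
  - eapply eventually_impl; [|exact (IHp _ _ _ (U _ _ _ _ s H))].
    simpl; intros m E; exact (f_equal (@Ex W s) E).
Qed.

Lemma capture_eventually s t (x : natvar t) :
  eventually (fun m => capture s m x = Var (vS x)).
Proof.
  exists (S x). intros m Hm. unfold capture.
  destruct (ty_eq_dec s t); [|reflexivity].
  destruct (Nat.eqb_spec x m); [lia|reflexivity].
Qed.

Lemma fresh_list s (H : list (fm natvar)) :
  eventually (fun m => map (fun q => fsub q (capture s m)) H = map fwk H).
Proof.
  induction H as [|q H IH]; simpl.
  - now exists 0.
  - eapply eventually_impl;
      [|exact (eventually_and (fsub_eventually q (f := capture s) (g := shift)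
        (@capture_eventually s)) IH)].
    simpl; intros m [E ->]; now rewrite E.
Qed.

(** Once the variable is fresh for [p], its occurrences in the instance are exactly those put in for
    [v0], so capturing undoes the instantiation. *)
Lemma fresh_inst s (p : fm (ext natvar s)) :
  eventually (fun m => fsub (inst p (Var m)) (capture s m) = p).
Proof.
  assert (E : eventually (fun m =>
    fsub p (scons x0 (capture s m)) = fsub p idsub)).
  { apply fsub_eventually. intros t x. destruct x as [|t x].
    - now exists 0.
    - apply (@capture_eventually s t x). }
  eapply eventually_impl; [|exact E]. simpl. intros m E'.
  rewrite fsub_inst. simpl. rewrite capture_self, inst_fsub_up, E'.
  apply fsub_id.
Qed.

(** * Models *)

(** The domains live in [Set] so that they can themselves be used as families of variables. The
    record carries no laws; they all come from [P_model]. *)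
Record model := Model {
  D : ty -> Set;
  app : forall s t, D (s ~> t) -> D s -> D t;
  cst : forall t, const t -> D t;
  st : forall t, D t -> Prop
}.
Arguments app {m s t} _ _.
Arguments cst {m t} _.
Arguments st {m t} _.

Definition env (M : model) (V : ty -> Set) := forall t, V t -> D M t.

Definition econs M V s (d : D M s) (e : env M V) : env M (ext V s) :=
  fun t x =>
  match x in ext _ _ t return D M t with
  | v0 => d
  | vS y => e _ y
  end.

Definition enil M : env M novar := fun t (x : novar t) => match x with end.

Fixpoint eval M V (e : env M V) t (a : tm V t) : D M t :=
  match a with
  | Var x => e _ x
  | Cst c => cst c
  | App f a => app (eval e f) (eval e a)
  end.

Fixpoint sat M V (p : fm V) : env M V -> Prop :=
  match p with
  | Bot => fun e => False
  | Eq a b => fun e => eval e a = eval e b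
  | St a => fun e => st (eval e a)
  | Imp p q => fun e => sat p e -> sat q e
  | And p q => fun e => sat p e /\ sat q e
  | Or p q => fun e => sat p e \/ sat q e
  | All s p => fun e => forall d : D M s, sat p (econs d e)
  | Ex s p => fun e => exists d : D M s, sat p (econs d e)
  end.

Definition P_model (M : model) :=
  forall V (p : fm V) (e : env M V), ax_P p -> sat p e.

(** * Completeness *)

Definition consistent (H : list (fm natvar)) := ~ derivable ax_P H Bot.

Lemma consistent_split H q :
  consistent H -> consistent (q :: H) \/ consistent (Neg q :: H).
Proof.
  intros C. apply NNPP. intros K. apply C.
  assert (K1 : derivable ax_P (q :: H) Bot) by (apply NNPP; intro; tauto).
  assert (K2 : derivable ax_P (Neg q :: H) Bot) by (apply NNPP; intro; tauto).
  eapply d_impE; apply d_impI; [apply K2 | apply K1].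
Qed.

(** A refutation of the instance at a fresh variable becomes, after capturing that variable, the
    second premise of existential elimination, and would refute [Ex s p] itself. *)
Lemma consistent_witness H s (p : fm (ext natvar s)) :
  consistent (Ex s p :: H) ->
  exists a, consistent (inst p a :: Ex s p :: H).
Proof.
  intros C.
  destruct (eventually_and (fresh_list s (Ex s p :: H)) (fresh_inst p))
    as [m Hm].
  destruct (Hm m (Nat.le_refl m)) as [E1 E2].
  exists (Var m). intros D. apply C.
  apply (d_exE (p := p)); [now apply d_hyp; left|].
  apply derivable_sub with (f := capture s m) in D. cbn [map] in D.
  rewrite E2 in D. cbn [map] in E1. rewrite E1 in D. exact D.
Qed.

Lemma henkin_step (H : list (fm natvar)) (q : fm natvar) : consistent H ->
  exists H', consistent H' /\ incl H H' /\ (In q H' \/ In (Neg q) H') /\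
    match q with
    | Ex s p => In q H' -> exists a, In (inst p a) H'
    | _ => True
    end.
Proof.
  intros C. destruct (consistent_split q C) as [D|D].
  - assert (G : consistent (q :: H) /\ incl H (q :: H)
      /\ (In q (q :: H) \/ In (Neg q) (q :: H)))
      by (split; [exact D|split; [now apply incl_tl | left; now left]]).
    destruct q; 
      try (match type of D with consistent ?K => exists K end; tauto).
    destruct (consistent_witness D) as [a Ca].
    exists (inst q a :: Ex s q :: H). split; [exact Ca|]. split.
    + now do 2 apply incl_tl.
    + split; [left; right; now left|]. intros _. exists a. now left.
  - exists (Neg q :: H). split; [exact D|]. split; [now apply incl_tl|].
    split; [right; now left|].
    (* With [Neg q] in the list, an existential [q] cannot be there as well without contradicting
       consistency, so the witness clause holds vacuously. *)
    destruct q; try exact I. intros [E|K]; [discriminate E|].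
    exfalso. apply D. eapply d_impE; apply d_hyp; [now left|now right].
Qed.

(** * A maximal consistent theory with witnesses, and its term model *)

Section Henkin.

Variable H0 : list (fm natvar).
Hypothesis H0_consistent : consistent H0.

Lemma henkin_sequence : exists H : nat -> list (fm natvar),
  H 0 = H0 /\ forall n, consistent (H n) /\ incl (H n) (H (S n)) /\
    (In (enum_fm n) (H (S n)) \/ In (Neg (enum_fm n)) (H (S n))) /\
    match enum_fm n with
    | Ex s p => In (enum_fm n) (H (S n)) -> exists a, In (inst p a) (H (S n))
    | _ => True
    end.
Proof.
  pose (X := {H | consistent H}).
  assert (St : forall n (h : X), {h' : X | incl (proj1_sig h) (proj1_sig h') /\
    (In (enum_fm n) (proj1_sig h') \/ In (Neg (enum_fm n)) (proj1_sig h')) /\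
    match enum_fm n with
    | Ex s p => In (enum_fm n) (proj1_sig h') ->
        exists a, In (inst p a) (proj1_sig h')
    | _ => True
    end}).
  { intros n [H C]. apply constructive_indefinite_description.
    destruct (henkin_step (enum_fm n) C) as (H' & C' & R).
    now exists (exist _ H' C'). }
  pose (h := fix h n : X := match n with
    | 0 => exist _ H0 H0_consistent
    | S n => proj1_sig (St n (h n))
    end).
  exists (fun n => proj1_sig (h n)). split; [reflexivity|]. intros n.
  split; [exact (proj2_sig (h n))|].
  exact (proj2_sig (St n (h n))).
Qed.

Definition henkin_seq :=
  proj1_sig (constructive_indefinite_description _ henkin_sequence).

Definition T (p : fm natvar) := exists n, In p (henkin_seq n).

Lemma henkin_seq_0 : henkin_seq 0 = H0.
Proof.
  exact (proj1 (proj2_sig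
    (constructive_indefinite_description _ henkin_sequence))).
Qed.

Lemma henkin_seq_spec n :
  consistent (henkin_seq n) /\ incl (henkin_seq n) (henkin_seq (S n)) /\
    (In (enum_fm n) (henkin_seq (S n)) \/ In (Neg (enum_fm n)) (henkin_seq (S n))) /\
    match enum_fm n with
    | Ex s p => In (enum_fm n) (henkin_seq (S n)) ->
        exists a, In (inst p a) (henkin_seq (S n))
    | _ => True
    end.
Proof.
  exact (proj2 (proj2_sig
    (constructive_indefinite_description _ henkin_sequence)) n).
Qed.

Lemma henkin_seq_mono n m : n <= m -> incl (henkin_seq n) (henkin_seq m).
Proof.
  induction 1; [apply incl_refl|].
  eapply incl_tran; [eassumption|apply henkin_seq_spec].
Qed.

Lemma T_finite (l : list (fm natvar)) : (forall p, In p l -> T p) ->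
  exists n, incl l (henkin_seq n).
Proof.
  induction l as [|p l IH]; intros Hl.
  - exists 0. intros q [].
  - destruct IH as [n Hn]; [intros q Hq; apply Hl; now right|].
    destruct (Hl p) as [m Hm]; [now left|].
    exists (max n m). apply incl_cons.
    + revert Hm. apply henkin_seq_mono. lia.
    + eapply incl_tran; [exact Hn|]. apply henkin_seq_mono. lia.
Qed.

Lemma T_consistent : ~ T Bot.
Proof.
  intros [n Hn]. apply (proj1 (henkin_seq_spec n)). now apply d_hyp.
Qed.

(** Every formula is decided at some stage. If [p] was decided negatively, a later stage contains
    [Neg p] together with all premises and would be inconsistent. *)
Lemma T_closed l p : (forall q, In q l -> T q) -> derivable ax_P l p -> T p.
Proof.
  intros Hl D. destruct (T_finite Hl) as [n Hn].
  destruct (enum_fm_surj p) as [m Em].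
  destruct (henkin_seq_spec m) as (_ & _ & [K|K] & _); rewrite Em in K.
  - now exists (S m).
  - exfalso. apply (proj1 (henkin_seq_spec (max n (S m)))).
    apply (d_impE (p := p)).
    + apply d_hyp. revert K. apply henkin_seq_mono. lia.
    + apply (derivable_weaken D). eapply incl_tran; [exact Hn|].
      apply henkin_seq_mono. lia.
Qed.

Lemma T_derivable p : derivable ax_P [] p -> T p.
Proof. apply T_closed. intros q []. Qed.

Lemma T_derivable1 p q : T p -> derivable ax_P [p] q -> T q.
Proof. intros Hp. apply T_closed. intros r [<-|[]]. exact Hp. Qed.

Lemma T_derivable2 p q r : T p -> T q -> derivable ax_P [p; q] r -> T r.
Proof.
  intros Hp Hq. apply T_closed. intros u [<-|[<-|[]]]; assumption.
Qed.

Lemma T_total p : T p \/ T (Neg p).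
Proof.
  destruct (enum_fm_surj p) as [m Em].
  destruct (henkin_seq_spec m) as (_ & _ & [K|K] & _); rewrite Em in K;
    [left|right]; now exists (S m).
Qed.

Lemma T_imp p q : T (p ->o q) <-> (T p -> T q).
Proof.
  split.
  - intros Hpq Hp. apply (T_derivable2 Hpq Hp).
    eapply d_impE; apply d_hyp; [now left | right; now left].
  - intros K. destruct (T_total p) as [Hp|Hp].
    + apply (T_derivable1 (K Hp)). apply d_impI, d_hyp. right; now left.
    + apply (T_derivable1 Hp). apply d_impI, d_raa.
      eapply d_impE; apply d_hyp; [right; right; now left | right; now left].
Qed.

Lemma T_and p q : T (p /\o q) <-> T p /\ T q.
Proof.
  split.
  - intros K; split; apply (T_derivable1 K);
      [eapply d_andE1 | eapply d_andE2]; apply d_hyp; now left.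
  - intros [Hp Hq]. apply (T_derivable2 Hp Hq).
    apply d_andI; apply d_hyp; [now left | right; now left].
Qed.

Lemma T_or p q : T (p \/o q) <-> T p \/ T q.
Proof.
  split.
  - intros K. destruct (T_total p) as [Hp|Hp]; [now left|]. right.
    apply (T_derivable2 K Hp).
    eapply d_orE; [apply d_hyp; now left| |].
    + apply d_raa. eapply d_impE; apply d_hyp;
        [do 3 right; now left | right; now left].
    + apply d_hyp; now left.
  - intros [K|K]; apply (T_derivable1 K);
      [apply d_orI1 | apply d_orI2]; apply d_hyp; now left.
Qed.

Lemma T_ex s (p : fm (ext natvar s)) : T (Ex s p) <-> exists a, T (inst p a).
Proof.
  split.
  - intros K. destruct (enum_fm_surj (Ex s p)) as [m Em].
    destruct (henkin_seq_spec m) as (_ & _ & D & W).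
    rewrite Em in D, W. destruct D as [D|D].
    + destruct (W D) as [a Ha]. exists a. now exists (S m).
    + exfalso. apply T_consistent.
      assert (D' : T (Neg (Ex s p))) by now exists (S m).
      now apply (proj1 (T_imp _ _) D').
  - intros [a K]. apply (T_derivable1 K). apply d_exI with a.
    apply d_hyp; now left.
Qed.

Lemma T_all s (p : fm (ext natvar s)) : T (All s p) <-> forall a, T (inst p a).
Proof.
  split.
  - intros K a. apply (T_derivable1 K), d_allE, d_hyp. now left.
  - intros K. destruct (T_total (All s p)) as [D|D]; [exact D|]. exfalso.
    (* The universal case is reduced to the existential one: classical logic turns the negation into
       a formal counterexample, for which the theory has a witness. *)
    assert (E : T (Ex s (Neg p))).
    { apply (T_derivable1 D). apply d_raa.
      apply (d_impE (p := All s p)); [apply d_hyp; right; now left|].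
      apply d_allI. apply d_raa. cbn [map].
      apply (d_impE (p := fwk (Ex s (Neg p))));
        [apply d_hyp; right; now left|].
      unfold fwk; cbn [fsub]. apply d_exI with (a := x0).
      change (Neg (fsub p (up shift))) with (fsub (Neg p) (@up _ _ s (@shift _ s))).
      rewrite inst_up_shift. apply d_hyp. now left. }
    apply T_ex in E as [a Ha]. apply T_consistent.
    exact (proj1 (T_imp _ _) Ha (K a)).
Qed.

Lemma T_leibniz s (p : fm (ext natvar s)) a b :
  internal p = true -> T (a =o b) -> T (inst p a) -> T (inst p b).
Proof.
  intros Hp E. apply T_imp. revert E. apply T_imp.
  apply T_derivable, d_ax, ax_int, ax_leibniz, Hp.
Qed.

Lemma T_refl s (a : tm natvar s) : T (a =o a).
Proof. apply T_derivable, d_ax, ax_int, ax_refl. Qed.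

Lemma inst_twk V s t (a : tm V t) (b : tm V s) :
  tsub (scons b (fun t x => Var x)) (twk a) = a.
Proof.
  change (fun t x => Var x) with (@idsub V).
  now rewrite tsub_twk_scons, tsub_id.
Qed.

Lemma T_subst s t (f : tm (ext natvar s) t) (a b : tm natvar s) :
  T (a =o b) ->
  T (tsub (scons a idsub) f =o tsub (scons b idsub) f).
Proof.
  intros E.
  assert (K := @T_leibniz s (twk (tsub (scons a idsub) f) =o f) a b
    eq_refl E).
  unfold inst in K. cbn [fsub] in K. rewrite !inst_twk in K. apply K, T_refl.
Qed.

Lemma T_sym s (a b : tm natvar s) : T (a =o b) -> T (b =o a).
Proof.
  intros E. assert (K := @T_leibniz s (x0 =o twk a) a b eq_refl E).
  unfold inst in K. cbn [fsub tsub] in K. rewrite !inst_twk in K.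
  apply K, T_refl.
Qed.

Lemma T_trans s (a b c : tm natvar s) :
  T (a =o b) -> T (b =o c) -> T (a =o c).
Proof.
  intros E F. assert (K := @T_leibniz s (twk a =o x0) b c eq_refl F).
  unfold inst in K. cbn [fsub tsub] in K. rewrite !inst_twk in K.
  now apply K.
Qed.

Lemma T_app s t (f g : tm natvar (s ~> t)) a b :
  T (f =o g) -> T (a =o b) -> T (f $ a =o g $ b).
Proof.
  intros E F. apply T_trans with (g $ a).
  - assert (K := T_subst (x0 $ twk a) E). cbn [tsub] in K.
    unfold idsub in K. rewrite !inst_twk in K. exact K.
  - assert (K := T_subst (twk g $ x0) F). cbn [tsub] in K.
    unfold idsub in K. rewrite !inst_twk in K. exact K.
Qed.

(** A chosen representative of the class of [a] modulo equality in [T]. It makes the quotient a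
    subset type, on which equality in [T] turns into equality in Rocq. *)
Definition norm s (a : tm natvar s) : tm natvar s :=
  epsilon (inhabits a) (fun b => T (a =o b)).

Lemma T_norm s (a : tm natvar s) : T (a =o norm a).
Proof.
  apply (epsilon_spec (inhabits a) (fun b => T (a =o b))).
  exists a. apply T_refl.
Qed.

Lemma norm_eq s (a b : tm natvar s) : T (a =o b) <-> norm a = norm b.
Proof.
  split.
  - intros E. unfold norm.
    replace (fun c => T (a =o c)) with (fun c => T (b =o c)).
    (* The two choices still differ in their inhabitation proofs, [inhabits a] and [inhabits b]. *)
    + f_equal. apply proof_irrelevance.
    + apply functional_extensionality. intros c.
      apply propositional_extensionality.
      split; apply T_trans; [exact E | now apply T_sym].
  - intros E. eapply T_trans; [apply T_norm|]. rewrite E. apply T_sym, T_norm.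
Qed.

Lemma norm_idem s (a : tm natvar s) : norm (norm a) = norm a.
Proof. apply norm_eq, T_sym, T_norm. Qed.

Definition quot (s : ty) : Set := {a : tm natvar s | norm a = a}.

Definition cls s (a : tm natvar s) : quot s := exist _ (norm a) (norm_idem a).

Lemma cls_eq s (a b : tm natvar s) : cls a = cls b <-> T (a =o b).
Proof.
  split.
  - intros E. apply norm_eq. exact (f_equal (@proj1_sig _ _) E).
  - intros E. apply subset_eq_compat. now apply norm_eq.
Qed.

Lemma cls_proj s (d : quot s) : cls (proj1_sig d) = d.
Proof. destruct d as [a Ha]. now apply subset_eq_compat. Qed.

Lemma T_proj_cls s (a : tm natvar s) : T (proj1_sig (cls a) =o a).
Proof. apply T_sym, T_norm. Qed.

Definition term_model : model := {|
  D := quot;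
  app s t f a := cls (proj1_sig f $ proj1_sig a);
  cst t c := cls (Cst c);
  st t a := T (St (proj1_sig a))
|}.

Definition cls_env V (f : sub V natvar) : env term_model V :=
  fun t x => cls (f t x).

Lemma eval_cls V (f : sub V natvar) t (a : tm V t) :
  eval (cls_env f) a = cls (tsub f a).
Proof.
  induction a as [t x|t c|s t a IHa b IHb]; simpl; try reflexivity.
  rewrite IHa, IHb. apply cls_eq. apply T_app; apply T_proj_cls.
Qed.

Lemma econs_cls V s (f : sub V natvar) (a : tm natvar s) :
  econs (M := term_model) (cls a) (cls_env f) = cls_env (scons a f).
Proof. now apply ext_eq. Qed.

(** Leibniz's scheme is restricted to internal formulas, so the compatibility of [St] with equality
    has to come from its own axiom. *)
Lemma T_st s (a b : tm natvar s) : T (a =o b) -> T (St a) -> T (St b).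
Proof.
  intros E F. assert (K : T (St a /\o a =o b)) by now apply T_and.
  revert K. apply T_imp. apply T_derivable, d_ax, ax_st_eq.
Qed.

(** Stated for all substitutions into terms so that the induction passes binders: every element of
    the model is the class of a term, hence quantifying over elements amounts to quantifying over
    instances. *)
Lemma truth V (p : fm V) : forall f : sub V natvar,
  sat p (cls_env f) <-> T (fsub p f).
Proof.
  induction p as [V|V s a b|V s a|V p IHp q IHq|V p IHp q IHq|V p IHp q IHq
    |V s p IHp|V s p IHp]; intros f; cbn [sat fsub].
  - split; [intros []|apply T_consistent].
  - rewrite !eval_cls. apply cls_eq.
  - rewrite eval_cls. split; apply T_st; [|apply T_sym]; apply T_proj_cls.
  - now rewrite T_imp, IHp, IHq.
  - now rewrite T_and, IHp, IHq.
  - now rewrite T_or, IHp, IHq.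
  - rewrite T_all. split.
    + intros K a. rewrite inst_fsub_up. apply IHp. rewrite <- econs_cls.
      apply K.
    + intros K d. rewrite <- (cls_proj d), econs_cls. apply IHp.
      rewrite <- inst_fsub_up. apply K.
  - rewrite T_ex. split.
    + intros [d K]. exists (proj1_sig d). rewrite inst_fsub_up. apply IHp.
      rewrite <- econs_cls, cls_proj. exact K.
    + intros [a K]. exists (cls a). rewrite econs_cls. apply IHp.
      rewrite <- inst_fsub_up. exact K.
Qed.

Lemma term_model_P : P_model term_model.
Proof.
  intros V p e Hp.
  replace e with (cls_env (fun t x => proj1_sig (e t x))).
  - apply truth, T_derivable, d_ax, ax_P_sub, Hp.
  - apply functional_extensionality_dep; intros t.
    apply functional_extensionality_dep; intros x. apply cls_proj.
Qed.

End Henkin.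

Theorem completeness (p : fm novar) :
  (forall M, P_model M -> sat p (enil M)) -> P_proves p.
Proof.
  intros K. apply NNPP. intros Hp.
  pose (i := (fun t (x : novar t) => match x with end) : sub novar natvar).
  assert (C : consistent [Neg (fsub p i)]).
  { intros D. apply Hp. apply d_raa in D.
    (* The refutation may use the variables of [natvar]. Since every type has a closed term,
       substituting [default] brings it back to a derivation without free variables. *)
    apply derivable_sub
      with (W := novar) (f := fun t (_ : natvar t) => default t) in D.
    rewrite fsub_fsub in D.
    replace (sub_comp _ i) with (@idsub novar) in D
      by (apply sub_eq; intros ? []).
    rewrite fsub_id in D. exact D. }
  assert (E : sat p (enil (term_model C))) by apply K, term_model_P.
  replace (enil (term_model C)) with (cls_env C i) in E.
  - apply truth in E. apply (T_consistent (H0_consistent := C)).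
    revert E. apply T_imp. exists 0. rewrite henkin_seq_0. now left.
  - apply functional_extensionality_dep; intros t.
    apply functional_extensionality_dep; intros [].
Qed.
(** * Semantics of substitution and abstraction *)

Lemma env_eq M V (e e' : env M V) : (forall t x, e t x = e' t x) -> e = e'.
Proof.
  intros H. apply functional_extensionality_dep; intros t.
  apply functional_extensionality_dep; intros x. apply H.
Qed.

Definition eval_sub M V W (e : env M W) (f : sub V W) : env M V :=
  fun t x => eval e (f t x).

Lemma eval_tsub M V W (e : env M W) (f : sub V W) t (a : tm V t) :
  eval e (tsub f a) = eval (eval_sub e f) a.
Proof. induction a; simpl; rewrite ?IHa1, ?IHa2; reflexivity. Qed.

Lemma eval_twk M V (e : env M V) s (d : D M s) t (a : tm V t) :
  eval (econs d e) (twk a) = eval e a.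
Proof. unfold twk. now rewrite eval_tsub. Qed.

Lemma eval_of_closed M V (e : env M V) t (a : tm novar t) :
  eval e (of_closed a) = eval (enil M) a.
Proof.
  unfold of_closed. rewrite eval_tsub. f_equal. apply env_eq. intros ? [].
Qed.

Lemma eval_sub_up M V W (e : env M W) (f : sub V W) s (d : D M s) :
  eval_sub (econs d e) (up f) = econs d (eval_sub e f).
Proof. apply ext_eq; [reflexivity|]. intros t x. apply eval_twk. Qed.

Lemma sat_fsub M V (p : fm V) : forall W (e : env M W) (f : sub V W),
  sat (fsub p f) e <-> sat p (eval_sub e f).
Proof.
  induction p as [V|V s a b|V s a|V p IHp q IHq|V p IHp q IHq|V p IHp q IHq
    |V s p IHp|V s p IHp]; intros W e f; cbn [sat fsub];
    rewrite ?eval_tsub, ?IHp, ?IHq; try tauto.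
  - split; intros H d; [rewrite <- eval_sub_up; apply IHp, H|].
    apply IHp. rewrite eval_sub_up. apply H.
  - split; intros [d H]; exists d; [rewrite <- eval_sub_up; apply IHp, H|].
    apply IHp. rewrite eval_sub_up. apply H.
Qed.

Lemma sat_inst M V (e : env M V) s (p : fm (ext V s)) a :
  sat (inst p a) e <-> sat p (econs (eval e a) e).
Proof.
  unfold inst. rewrite sat_fsub.
  replace (eval_sub e _) with (econs (eval e a) e); [tauto|].
  now apply ext_eq.
Qed.

Section Model.

Variable M : model.
Hypothesis HM : P_model M.

Local Notation D := (D M).
Local Notation "f · a" := (app f a) (at level 40, left associativity).

(** The elements of the model are used as the free variables of formulas, so
    that a parameter is named by itself. *)
Definition param : env M D := fun t d => d.

Lemma epa V (p : fm V) (e : env M V) : ax_EPA p -> sat p e.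
Proof. intros H. now apply HM, ax_int. Qed.

Lemma appK s t (a : D s) (b : D t) : cst (cK s t) · a · b = a.
Proof. exact (epa param (ax_K (Var a) (Var b))). Qed.

Lemma appS r s t (a : D (r ~> s ~> t)) (b : D (r ~> s)) (c : D r) :
  cst (cS r s t) · a · b · c = a · c · (b · c).
Proof. exact (epa param (ax_S (Var a) (Var b) (Var c))). Qed.

(** Beta conversion for bracket abstraction, from the equations of K and S. All later computations
    with closed terms rest on it. *)
Lemma app_lam V (e : env M V) s t (a : tm (ext V s) t) (d : D s) :
  eval e (lam a) · d = eval (econs d e) a.
Proof.
  induction a as [t x|t c|r t a IHa b IHb]; simpl.
  - destruct x; simpl; [now rewrite appS, appK|apply appK].
  - apply appK.
  - now rewrite appS, IHa, IHb.
Qed.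

Definition zero : D N := cst cZero.
Definition succ (n : D N) : D N := cst cSucc · n.
Definition one : D N := succ zero.
Definition nil : D (Seq N) := cst (cNil N).
Definition cons (a : D N) (l : D (Seq N)) : D (Seq N) := cst (cCons N) · a · l.

Lemma succ_zero n : succ n <> zero.
Proof. exact (epa param (ax_succ0 (Var n))). Qed.

Lemma succ_inj m n : succ m = succ n -> m = n.
Proof. exact (epa param (ax_succ_inj (Var m) (Var n))). Qed.

Lemma rec_zero s (a : D s) f : cst (cRec s) · a · f · zero = a.
Proof. exact (epa param (ax_Rec0 (Var a) (Var f))). Qed.

Lemma rec_succ s (a : D s) f n :
  cst (cRec s) · a · f · succ n = f · (cst (cRec s) · a · f · n) · n.
Proof. exact (epa param (ax_RecS (Var a) (Var f) (Var n))). Qed.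

Lemma lrec_nil t (a : D t) f : cst (cLRec N t) · a · f · nil = a.
Proof. exact (epa param (ax_LRec0 (Var a) (Var f))). Qed.

Lemma lrec_cons t (a : D t) f b l :
  cst (cLRec N t) · a · f · cons b l = f · (cst (cLRec N t) · a · f · l) · b.
Proof. exact (epa param (ax_LRecC (Var a) (Var f) (Var b) (Var l))). Qed.

Lemma list_cases l : l = nil \/ exists a k, l = cons a k.
Proof. exact (epa param (ax_SA (Var l))). Qed.

(** The only induction available for all numbers of the model. Uses of it write the property as a
    formula [p], with elements of the model as parameters, and recover the readable form by
    [change]. *)
Lemma induction (p : fm (ext D N)) : internal p = true ->
  sat p (econs zero param) ->
  (forall n, sat p (econs n param) -> sat p (econs (succ n) param)) ->
  forall n, sat p (econs n param).
Proof.
  intros Hp H0 HS. apply (epa param (ax_ind Hp)). split.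
  - now apply sat_inst.
  - intros n Hn. unfold at_succ. apply sat_fsub.
    replace (eval_sub _ _) with (econs (succ n) param) by now apply ext_eq.
    now apply HS.
Qed.

Lemma external_induction (p : fm (ext D N)) :
  sat p (econs zero param) ->
  (forall n, st n -> sat p (econs n param) -> sat p (econs (succ n) param)) ->
  forall n, st n -> sat p (econs n param).
Proof.
  intros H0 HS. apply (HM param (ax_ext_ind p)). split.
  - now apply sat_inst.
  - intros n Hst Hn. unfold at_succ. apply sat_fsub.
    replace (eval_sub _ _) with (econs (succ n) param) by now apply ext_eq.
    now apply HS.
Qed.

Lemma st_closed t (a : tm novar t) : st (eval (enil M) a).
Proof.
  rewrite <- (eval_of_closed param). exact (HM param (ax_st_closed D a)).
Qed.

Lemma st_app s t (f : D (s ~> t)) (a : D s) : st f -> st a -> st (f · a).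
Proof.
  intros Hf Ha. exact (HM param (ax_st_app (Var f) (Var a)) (conj Hf Ha)).
Qed.

(** ** Arithmetic *)

(** The operations of the syntax as elements of the model; in this form they
    can serve as parameters of induction formulas. *)
Definition addF := eval (enil M) (lam (lam (plus x1 x0))).
Definition lenF := eval (enil M) (lam (@len _ N x0)).
Definition nthF := eval (enil M) (lam (@nthf _ N x0)).
Definition rconsF := eval (enil M) (lam (lam (@rcons _ N x1 x0))).
Definition initF := eval (enil M) (lam (lam (@initseg _ N x1 x0))).
Definition triF := eval (enil M) (lam (triangle x0)).
Definition pairF := eval (enil M) (lam (lam (pair x1 x0))).
Definition codeF := eval (enil M) (lam (code x0)).

Lemma eval_plus V (e : env M V) a b :
  eval e (plus a b) = addF · eval e a · eval e b.
Proof. unfold addF. now rewrite !app_lam. Qed.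

Lemma eval_len V (e : env M V) (l : tm V (Seq N)) :
  eval e (len l) = lenF · eval e l.
Proof. unfold lenF. now rewrite !app_lam. Qed.

Lemma eval_nthf V (e : env M V) (l : tm V (Seq N)) :
  eval e (nthf l) = nthF · eval e l.
Proof. unfold nthF. now rewrite !app_lam. Qed.

Lemma eval_rcons V (e : env M V) (l : tm V (Seq N)) a :
  eval e (rcons l a) = rconsF · eval e l · eval e a.
Proof. unfold rconsF. now rewrite !app_lam. Qed.

Lemma eval_initseg V (e : env M V) (f : tm V (N ~> N)) n :
  eval e (initseg f n) = initF · eval e f · eval e n.
Proof. unfold initF. now rewrite !app_lam. Qed.

Lemma eval_triangle V (e : env M V) n : eval e (triangle n) = triF · eval e n.
Proof. unfold triF. now rewrite !app_lam. Qed.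

Lemma eval_pair V (e : env M V) a b :
  eval e (pair a b) = pairF · eval e a · eval e b.
Proof. unfold pairF. now rewrite !app_lam. Qed.

Lemma eval_code V (e : env M V) l : eval e (code l) = codeF · eval e l.
Proof. unfold codeF. now rewrite !app_lam. Qed.

Lemma eval_bar V (e : env M V) f n :
  eval e (bar f n) = codeF · (initF · eval e f · eval e n).
Proof. unfold bar. now rewrite eval_code, eval_initseg. Qed.

Local Notation "a [+] b" := (addF · a · b) (at level 50, left associativity).

Local Ltac ev := rewrite ?app_lam; cbn [eval econs].

Lemma add_0_r a : a [+] zero = a.
Proof. unfold addF, plus. ev. apply rec_zero. Qed.

Lemma add_succ_r a b : a [+] succ b = succ (a [+] b).
Proof. unfold addF, plus. ev. rewrite rec_succ. ev. reflexivity. Qed.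

Lemma tri_succ n : triF · succ n = triF · n [+] succ n.
Proof.
  unfold triF, triangle. ev. rewrite rec_succ. ev. now rewrite eval_plus.
Qed.

Lemma pair_eq a b : pairF · a · b = triF · (a [+] b) [+] a.
Proof.
  unfold pairF, pair. ev. now rewrite !eval_plus, eval_triangle, eval_plus.
Qed.

Lemma len_nil : lenF · nil = zero.
Proof. unfold lenF, len. ev. apply lrec_nil. Qed.

Lemma len_cons a l : lenF · cons a l = succ (lenF · l).
Proof. unfold lenF, len. ev. rewrite lrec_cons. ev. reflexivity. Qed.

Lemma nth_nil i : nthF · nil · i = zero.
Proof. unfold nthF, nthf. ev. rewrite lrec_nil. apply appK. Qed.

Lemma nth_cons_0 a l : nthF · cons a l · zero = a.
Proof. unfold nthF, nthf. ev. rewrite lrec_cons. ev. apply rec_zero. Qed.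

Lemma nth_cons_succ a l i : nthF · cons a l · succ i = nthF · l · i.
Proof.
  unfold nthF, nthf. ev. rewrite lrec_cons. ev. rewrite rec_succ. ev.
  reflexivity.
Qed.

Lemma rcons_nil a : rconsF · nil · a = cons a nil.
Proof. unfold rconsF, rcons. ev. apply lrec_nil. Qed.

Lemma rcons_cons b l a : rconsF · cons b l · a = cons b (rconsF · l · a).
Proof. unfold rconsF, rcons. ev. rewrite lrec_cons. ev. reflexivity. Qed.

Lemma init_0 f : initF · f · zero = nil.
Proof. unfold initF, initseg. ev. apply rec_zero. Qed.

Lemma init_succ f n :
  initF · f · succ n = rconsF · (initF · f · n) · (f · n).
Proof.
  unfold initF, initseg. ev. rewrite rec_succ. ev. now rewrite eval_rcons.
Qed.

Lemma code_nil : codeF · nil = zero.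
Proof. unfold codeF, code. ev. apply lrec_nil. Qed.

Lemma code_cons a l : codeF · cons a l = succ (pairF · a · (codeF · l)).
Proof.
  unfold codeF, code. ev. rewrite lrec_cons. ev. unfold Succ. cbn [eval].
  now rewrite eval_pair.
Qed.

Lemma nat_cases n : n = zero \/ exists m, n = succ m.
Proof.
  apply (induction (p := x0 =o Zero \/o Ex N (x1 =o Succ x0)) eq_refl).
  - now left.
  - intros m _. right. now exists m.
Qed.

Lemma add_0_l n : zero [+] n = n.
Proof.
  apply (induction (p := Var (vS addF) $ Zero $ x0 =o x0) eq_refl); simpl.
  - apply add_0_r.
  - intros m IH. change (zero [+] succ m = succ m). rewrite add_succ_r.
    exact (f_equal succ IH).
Qed.

Lemma add_succ_l m n : succ m [+] n = succ (m [+] n).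
Proof.
  apply (induction (p := Var (vS addF) $ Succ (Var (vS m)) $ x0
    =o Succ (Var (vS addF) $ Var (vS m) $ x0)) eq_refl); simpl.
  - change (succ m [+] zero = succ (m [+] zero)). now rewrite !add_0_r.
  - intros k IH. change (succ m [+] succ k = succ (m [+] succ k)).
    rewrite !add_succ_r. exact (f_equal succ IH).
Qed.

Lemma add_comm m n : m [+] n = n [+] m.
Proof.
  apply (induction (p := Var (vS addF) $ Var (vS m) $ x0
    =o Var (vS addF) $ x0 $ Var (vS m)) eq_refl); simpl.
  - change (m [+] zero = zero [+] m). now rewrite add_0_r, add_0_l.
  - intros k IH. change (m [+] succ k = succ k [+] m).
    rewrite add_succ_r, add_succ_l. exact (f_equal succ IH).
Qed.

Lemma add_assoc a b c : a [+] (b [+] c) = a [+] b [+] c.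
Proof.
  apply (induction (p := Var (vS addF) $ Var (vS a)
      $ (Var (vS addF) $ Var (vS b) $ x0)
    =o Var (vS addF) $ (Var (vS addF) $ Var (vS a) $ Var (vS b)) $ x0)
    eq_refl); simpl.
  - change (a [+] (b [+] zero) = a [+] b [+] zero). now rewrite !add_0_r.
  - intros k IH. change (a [+] (b [+] succ k) = a [+] b [+] succ k).
    rewrite !add_succ_r. exact (f_equal succ IH).
Qed.

Lemma add_cancel_r a b c : a [+] c = b [+] c -> a = b.
Proof.
  apply (induction (p := Var (vS addF) $ Var (vS a) $ x0
    =o Var (vS addF) $ Var (vS b) $ x0 ->o Var (vS a) =o Var (vS b))
    eq_refl); simpl.
  - change (a [+] zero = b [+] zero -> a = b). now rewrite !add_0_r.
  - intros k IH. change (a [+] succ k = b [+] succ k -> a = b).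
    rewrite !add_succ_r. intros E. now apply IH, succ_inj.
Qed.

Lemma add_cancel_l a b c : c [+] a = c [+] b -> a = b.
Proof. rewrite !(add_comm c). apply add_cancel_r. Qed.

Definition le a b := exists k, a [+] k = b.
Definition lt a b := le (succ a) b.

Lemma sat_Le V (e : env M V) a b : sat (Le a b) e <-> le (eval e a) (eval e b).
Proof.
  unfold Le, le. cbn [sat].
  split; intros [k E]; exists k; rewrite ?eval_plus, ?eval_twk in *; exact E.
Qed.

Lemma sat_Lt V (e : env M V) a b : sat (Lt a b) e <-> lt (eval e a) (eval e b).
Proof. unfold Lt. now rewrite sat_Le. Qed.

Lemma le_0 n : le zero n.
Proof. exists n. apply add_0_l. Qed.

Lemma le_refl n : le n n.
Proof. exists zero. apply add_0_r. Qed.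

Lemma le_trans a b c : le a b -> le b c -> le a c.
Proof. intros [k <-] [j <-]. exists (k [+] j). apply add_assoc. Qed.

Lemma le_add_r a b : le a (a [+] b).
Proof. now exists b. Qed.

Lemma le_add_l a b : le b (a [+] b).
Proof. exists a. apply add_comm. Qed.

Lemma le_succ_r n : le n (succ n).
Proof. exists one. unfold one. now rewrite add_succ_r, add_0_r. Qed.

Lemma le_succ_iff m n : le (succ m) (succ n) <-> le m n.
Proof.
  split; intros [k E]; exists k; rewrite add_succ_l in *;
    [now apply succ_inj|now rewrite E].
Qed.

Lemma le_0_inv n : le n zero -> n = zero.
Proof.
  intros [k E]. destruct (nat_cases n) as [->|[m ->]]; [reflexivity|].
  rewrite add_succ_l in E. now apply succ_zero in E.
Qed.

Lemma le_cases a b : le a b -> a = b \/ lt a b.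
Proof.
  intros [k <-]. destruct (nat_cases k) as [->|[j ->]].
  - left. now rewrite add_0_r.
  - right. exists j. now rewrite add_succ_l, add_succ_r.
Qed.

Lemma lt_irrefl n : ~ lt n n.
Proof.
  intros [k E]. rewrite add_succ_l, <- add_succ_r in E.
  rewrite <- (add_0_r n) in E at 2. apply add_cancel_l in E.
  now apply succ_zero in E.
Qed.

Lemma lt_0_inv n : ~ lt n zero.
Proof. intros H. apply le_0_inv in H. now apply succ_zero in H. Qed.

Lemma lt_succ_cases a b : lt a (succ b) -> lt a b \/ a = b.
Proof.
  intros H. apply (proj1 (le_succ_iff a b)) in H.
  destruct (le_cases H); tauto.
Qed.

Lemma lt_le_trans a b c : lt a b -> le b c -> lt a c.
Proof. apply le_trans. Qed.

Lemma lt_le a b : lt a b -> le a b.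
Proof. apply le_trans, le_succ_r. Qed.

Lemma le_or_lt a b : le a b \/ lt b a.
Proof.
  apply (induction (p := Ex N (Var (vS (vS addF)) $ x1 $ x0 =o Var (vS (vS b)))
    \/o Ex N (Var (vS (vS addF)) $ Succ (Var (vS (vS b))) $ x0 =o x1))
    eq_refl).
  - left. exact (le_0 b).
  - intros n IH. change (le n b \/ lt b n) in IH.
    change (le (succ n) b \/ lt b (succ n)). destruct IH as [H|H].
    + destruct (le_cases H) as [->|K]; [right; apply le_refl|now left].
    + right. apply (lt_le_trans H), le_succ_r.
Qed.

Lemma tri_mono m n : le m n -> le (triF · m) (triF · n).
Proof.
  intros [k <-].
  apply (induction (p := Ex N (Var (vS (vS addF))
      $ (Var (vS (vS triF)) $ Var (vS (vS m))) $ x0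
    =o Var (vS (vS triF)) $ (Var (vS (vS addF)) $ Var (vS (vS m)) $ x1)))
    eq_refl).
  - change (le (triF · m) (triF · (m [+] zero))). rewrite add_0_r.
    apply le_refl.
  - intros j IH. change (le (triF · m) (triF · (m [+] succ j))).
    change (le (triF · m) (triF · (m [+] j))) in IH.
    rewrite add_succ_r, tri_succ. apply (le_trans IH), le_add_r.
Qed.

(** Cantor pairing lists the diagonals a + b = s one after another. With t(s) for the triangular
    number, t(s) + a < t(s) + s + 1 = t(s + 1), and the gap in the strict inequality is [b]. *)
Lemma pair_lt a b c d :
  lt (a [+] b) (c [+] d) -> lt (pairF · a · b) (pairF · c · d).
Proof.
  intros H. rewrite !pair_eq.
  apply lt_le_trans with (triF · succ (a [+] b)).
  - rewrite tri_succ. exists b.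
    now rewrite add_succ_l, add_succ_r, add_assoc.
  - eapply le_trans; [apply (tri_mono H)|apply le_add_r].
Qed.

(** By [pair_lt] equal codes lie on the same diagonal, and there the code determines the first
    component by cancellation. *)
Lemma pair_inj a b c d : pairF · a · b = pairF · c · d -> a = c /\ b = d.
Proof.
  intros E. assert (S : a [+] b = c [+] d).
  { destruct (le_or_lt (a [+] b) (c [+] d)) as [H|H].
    - apply le_cases in H as [H|H]; [exact H|].
      apply pair_lt in H. rewrite E in H. now apply lt_irrefl in H.
    - apply pair_lt in H. rewrite E in H. now apply lt_irrefl in H. }
  rewrite !pair_eq, S in E. apply add_cancel_l in E. subst c.
  split; [reflexivity|]. now apply add_cancel_l in S.
Qed.

Lemma le_pair_l a b : le a (pairF · a · b).
Proof. rewrite pair_eq. apply le_add_l. Qed.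

Lemma le_tri n : le n (triF · n).
Proof.
  destruct (nat_cases n) as [->|[m ->]]; [apply le_0|].
  rewrite tri_succ. apply le_add_l.
Qed.

Lemma le_pair_r a b : le b (pairF · a · b).
Proof.
  rewrite pair_eq. apply le_trans with (a [+] b); [apply le_add_l|].
  eapply le_trans; [apply le_tri|apply le_add_r].
Qed.

(** ** Finite sequences *)

(** The axioms give only a case distinction for sequences, so the induction runs over their
    lengths. *)
Lemma list_induction (p : fm (ext D (Seq N))) : internal p = true ->
  sat p (econs nil param) ->
  (forall a l, sat p (econs l param) -> sat p (econs (cons a l) param)) ->
  forall l, sat p (econs l param).
Proof.
  intros Hp H0 HS.
  (* Moves [p] to the context in which the length is a further variable between the sequence and the
     parameters. *)
  pose (f := scons x0 (fun t x => Var (vS (vS x)))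
    : sub (ext D (Seq N)) (ext (ext D N) (Seq N))).
  pose (q := All (Seq N) (Var (vS (vS lenF)) $ x0 =o x1 ->o fsub p f)).
  assert (Q : forall n, sat q (econs n param) <->
    forall l, lenF · l = n -> sat p (econs l param)).
  { intros n. unfold q. cbn [sat].
    split; intros H l E; specialize (H l E).
    - apply sat_fsub in H.
      replace (eval_sub _ _) with (econs l param) in H; [exact H|].
      now apply ext_eq.
    - apply sat_fsub.
      replace (eval_sub _ _) with (econs l param); [exact H|].
      now apply ext_eq. }
  assert (K : forall n, sat q (econs n param)).
  { apply induction.
    - simpl. now rewrite internal_fsub.
    - apply Q. intros l E. destruct (list_cases l) as [->|(a & k & ->)].
      + exact H0.
      + rewrite len_cons in E. now apply succ_zero in E.
    - intros n IH. apply Q. intros l E.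
      destruct (list_cases l) as [->|(a & k & ->)]; [exact H0|].
      rewrite len_cons in E. apply succ_inj in E. apply HS.
      revert E. now apply Q. }
  intros l. now apply (proj1 (Q (lenF · l)) (K _)).
Qed.

Lemma len_rcons l a : lenF · (rconsF · l · a) = succ (lenF · l).
Proof.
  apply (list_induction (p := Var (vS lenF) $ (Var (vS rconsF) $ x0 $ Var (vS a))
    =o Succ (Var (vS lenF) $ x0)) eq_refl).
  - change (lenF · (rconsF · nil · a) = succ (lenF · nil)).
    now rewrite rcons_nil, len_cons.
  - intros b k IH. change (lenF · (rconsF · k · a) = succ (lenF · k)) in IH.
    change (lenF · (rconsF · cons b k · a) = succ (lenF · cons b k)).
    now rewrite rcons_cons, !len_cons, IH.
Qed.

Lemma len_init f n : lenF · (initF · f · n) = n.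
Proof.
  apply (induction (p := Var (vS lenF) $ (Var (vS initF) $ Var (vS f) $ x0)
    =o x0) eq_refl).
  - change (lenF · (initF · f · zero) = zero). now rewrite init_0, len_nil.
  - intros m IH. change (lenF · (initF · f · m) = m) in IH.
    change (lenF · (initF · f · succ m) = succ m).
    now rewrite init_succ, len_rcons, IH.
Qed.

Lemma nth_rcons_lt l a i :
  lt i (lenF · l) -> nthF · (rconsF · l · a) · i = nthF · l · i.
Proof.
  revert i.
  apply (list_induction (p := All N (
    Ex N (Var (vS (vS (vS addF))) $ Succ x1 $ x0 =o Var (vS (vS (vS lenF))) $ x2)
    ->o Var (vS (vS nthF)) $ (Var (vS (vS rconsF)) $ x1 $ Var (vS (vS a))) $ x0
      =o Var (vS (vS nthF)) $ x1 $ x0)) eq_refl).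
  - change (forall i, lt i (lenF · nil) ->
      nthF · (rconsF · nil · a) · i = nthF · nil · i).
    intros i. rewrite len_nil. intros H. now apply lt_0_inv in H.
  - intros b k IH. change (forall i, lt i (lenF · k) ->
      nthF · (rconsF · k · a) · i = nthF · k · i) in IH.
    change (forall i, lt i (lenF · cons b k) ->
      nthF · (rconsF · cons b k · a) · i = nthF · cons b k · i).
    intros i. rewrite len_cons, rcons_cons. intros H.
    destruct (nat_cases i) as [->|[j ->]].
    + now rewrite !nth_cons_0.
    + rewrite !nth_cons_succ. apply IH. exact (proj1 (le_succ_iff _ _) H).
Qed.

Lemma nth_rcons_len l a : nthF · (rconsF · l · a) · (lenF · l) = a.
Proof.
  apply (list_induction (p := Var (vS nthF)
    $ (Var (vS rconsF) $ x0 $ Var (vS a)) $ (Var (vS lenF) $ x0) =o Var (vS a))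
    eq_refl).
  - change (nthF · (rconsF · nil · a) · (lenF · nil) = a).
    now rewrite rcons_nil, len_nil, nth_cons_0.
  - intros b k IH. change (nthF · (rconsF · k · a) · (lenF · k) = a) in IH.
    change (nthF · (rconsF · cons b k · a) · (lenF · cons b k) = a).
    now rewrite rcons_cons, len_cons, nth_cons_succ.
Qed.

Lemma nth_init f n i : lt i n -> nthF · (initF · f · n) · i = f · i.
Proof.
  apply (induction (p :=
    Ex N (Var (vS (vS addF)) $ Succ (Var (vS (vS i))) $ x0 =o x1)
    ->o Var (vS nthF) $ (Var (vS initF) $ Var (vS f) $ x0) $ Var (vS i)
      =o Var (vS f) $ Var (vS i)) eq_refl).
  - intros H. exfalso. exact (lt_0_inv H).
  - intros m IH. change (lt i m -> nthF · (initF · f · m) · i = f · i) in IH.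
    change (lt i (succ m) -> nthF · (initF · f · succ m) · i = f · i).
    intros H. rewrite init_succ. destruct (lt_succ_cases H) as [K| ->].
    + rewrite nth_rcons_lt; [now apply IH|]. now rewrite len_init.
    + rewrite <- (len_init f m) at 3. apply nth_rcons_len.
Qed.

(** The default entry is 0, so a finite 0-1 sequence read as a function is bounded by 1 everywhere
    and STP applies to it. *)
Lemma nth_ge l i : le (lenF · l) i -> nthF · l · i = zero.
Proof.
  revert i.
  apply (list_induction (p := All N (
    Ex N (Var (vS (vS (vS addF))) $ (Var (vS (vS (vS lenF))) $ x2) $ x0 =o x1)
    ->o Var (vS (vS nthF)) $ x1 $ x0 =o Zero)) eq_refl).
  - intros i _. exact (nth_nil i).
  - intros b k IH. change (forall i, le (lenF · k) i -> nthF · k · i = zero) in IH.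
    change (forall i, le (lenF · cons b k) i -> nthF · cons b k · i = zero).
    intros i. rewrite len_cons. intros H.
    destruct (nat_cases i) as [->|[j ->]].
    + now apply lt_0_inv in H.
    + rewrite nth_cons_succ. apply IH. exact (proj1 (le_succ_iff _ _) H).
Qed.

Lemma init_ext f g n :
  (forall i, lt i n -> f · i = g · i) -> initF · f · n = initF · g · n.
Proof.
  apply (induction (p :=
    All N (Ex N (Var (vS (vS (vS addF))) $ Succ x1 $ x0 =o x2)
      ->o Var (vS (vS f)) $ x0 =o Var (vS (vS g)) $ x0)
    ->o Var (vS initF) $ Var (vS f) $ x0 =o Var (vS initF) $ Var (vS g) $ x0)
    eq_refl).
  - intros _. change (initF · f · zero = initF · g · zero). now rewrite !init_0.
  - intros m IH. change ((forall i, lt i m -> f · i = g · i) ->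
      initF · f · m = initF · g · m) in IH.
    change ((forall i, lt i (succ m) -> f · i = g · i) ->
      initF · f · succ m = initF · g · succ m).
    intros H. rewrite !init_succ, IH, (H m); [reflexivity|apply le_refl|].
    intros i Hi. apply H. apply (lt_le_trans Hi), le_succ_r.
Qed.

Lemma code_inj l k : codeF · l = codeF · k -> l = k.
Proof.
  revert k.
  apply (list_induction (p := All (Seq N)
    (Var (vS (vS codeF)) $ x1 =o Var (vS (vS codeF)) $ x0 ->o x1 =o x0)) eq_refl).
  - change (forall k, codeF · nil = codeF · k -> nil = k). intros k E.
    destruct (list_cases k) as [->|(b & k' & ->)]; [reflexivity|].
    rewrite code_nil, code_cons in E. symmetry in E. now apply succ_zero in E.
  - intros a l' IH. change (forall k, codeF · l' = codeF · k -> l' = k) in IH.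
    change (forall k, codeF · cons a l' = codeF · k -> cons a l' = k).
    intros k E. destruct (list_cases k) as [->|(b & k' & ->)].
    + rewrite code_nil, code_cons in E. now apply succ_zero in E.
    + rewrite !code_cons in E. apply succ_inj, pair_inj in E as [-> E].
      now rewrite (IH _ E).
Qed.

(** Supplies the search bound for the function sending k to the code of an initial segment of length
    k. *)
Lemma len_le_code l : le (lenF · l) (codeF · l).
Proof.
  apply (list_induction (p := Ex N (Var (vS (vS addF))
    $ (Var (vS (vS lenF)) $ x1) $ x0 =o Var (vS (vS codeF)) $ x1)) eq_refl).
  - change (le (lenF · nil) (codeF · nil)). rewrite len_nil. apply le_0.
  - intros a k IH. change (le (lenF · k) (codeF · k)) in IH.
    change (le (lenF · cons a k) (codeF · cons a k)).
    rewrite len_cons, code_cons. apply le_succ_iff.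
    apply (le_trans IH), le_pair_r.
Qed.

Definition mem a l := exists i, lt i (lenF · l) /\ nthF · l · i = a.

Lemma sat_Mem V (e : env M V) a (l : tm V (Seq N)) :
  sat (Mem a l) e <-> mem (eval e a) (eval e l).
Proof.
  unfold Mem, mem. cbn [sat].
  split; intros [i [H E]]; exists i; split.
  - apply sat_Lt in H. now rewrite eval_len, eval_twk in H.
  - cbn [eval] in E. now rewrite eval_nthf, !eval_twk in E.
  - apply sat_Lt. now rewrite eval_len, eval_twk.
  - cbn [eval]. now rewrite eval_nthf, !eval_twk.
Qed.

Lemma mem_nil a : ~ mem a nil.
Proof. intros [i [H _]]. rewrite len_nil in H. now apply lt_0_inv in H. Qed.

Lemma mem_cons a b l : mem a (cons b l) -> a = b \/ mem a l.
Proof.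
  intros [i [H E]]. rewrite len_cons in H.
  destruct (nat_cases i) as [->|[j ->]].
  - left. now rewrite nth_cons_0 in E.
  - right. exists j. rewrite nth_cons_succ in E. split; [|exact E].
    exact (proj1 (le_succ_iff _ _) H).
Qed.

Definition sumF :=
  eval (enil M) (lam (Cst (cLRec N N) $ Zero $ lam (lam (plus x0 x1)) $ x0)).

Lemma sum_cons a l : sumF · cons a l = a [+] sumF · l.
Proof. unfold sumF. ev. rewrite lrec_cons. ev. now rewrite eval_plus. Qed.

Lemma mem_le_sum a l : mem a l -> le a (sumF · l).
Proof.
  apply (list_induction (p :=
    Ex N (Ex N (Var (vS (vS (vS addF))) $ Succ x1 $ x0
          =o Var (vS (vS (vS lenF))) $ x2)
      /\o Var (vS (vS nthF)) $ x1 $ x0 =o Var (vS (vS a)))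
    ->o Ex N (Var (vS (vS addF)) $ Var (vS (vS a)) $ x0
      =o Var (vS (vS sumF)) $ x1)) eq_refl).
  - intros H. exfalso. exact (mem_nil H).
  - intros b k IH. change (mem a k -> le a (sumF · k)) in IH.
    change (mem a (cons b k) -> le a (sumF · cons b k)).
    intros H. rewrite sum_cons. apply mem_cons in H as [->|H].
    + apply le_add_r.
    + apply (le_trans (IH H)), le_add_l.
Qed.

(** ** Definable functions *)

(** Double recursion: the outer recursor produces functions of the second argument. It starts with
    the test for 0, and its step sends a test e to the one that is 0 at 0 and e(c) at c + 1. *)
Definition eqF : D (N ~> N ~> N) := eval (enil M) (Cst (cRec (N ~> N))
  $ lam (Cst (cRec N) $ One $ lam (lam Zero) $ x0)
  $ lam (lam (lam (Cst (cRec N) $ Zero $ lam (lam (x4 $ x0)) $ x0)))).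

Lemma eqF_spec a b :
  (eqF · a · b = one /\ a = b) \/ (eqF · a · b = zero /\ a <> b).
Proof.
  assert (E00 : eqF · zero · zero = one).
  { unfold eqF. cbn [eval]. rewrite rec_zero. ev. apply rec_zero. }
  assert (E0S : forall b, eqF · zero · succ b = zero).
  { intros c. unfold eqF. cbn [eval]. rewrite rec_zero. ev. rewrite rec_succ.
    ev. reflexivity. }
  assert (ES0 : forall a, eqF · succ a · zero = zero).
  { intros c. unfold eqF. cbn [eval]. rewrite rec_succ. ev. apply rec_zero. }
  assert (ESS : forall a b, eqF · succ a · succ b = eqF · a · b).
  { intros c d. unfold eqF. cbn [eval]. rewrite rec_succ. ev.
    rewrite rec_succ. ev. reflexivity. }
  revert b. apply (induction (p := All N
    (Var (vS (vS eqF)) $ x1 $ x0 =o One /\o x1 =o x0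
     \/o Var (vS (vS eqF)) $ x1 $ x0 =o Zero /\o Neg (x1 =o x0))) eq_refl).
  - change (forall b, (eqF · zero · b = one /\ zero = b)
      \/ (eqF · zero · b = zero /\ zero <> b)).
    intros b. destruct (nat_cases b) as [->|[c ->]]; [now left|right].
    split; [apply E0S|]. intros E. symmetry in E. now apply succ_zero in E.
  - intros n IH. change (forall b, (eqF · n · b = one /\ n = b)
      \/ (eqF · n · b = zero /\ n <> b)) in IH.
    change (forall b, (eqF · succ n · b = one /\ succ n = b)
      \/ (eqF · succ n · b = zero /\ succ n <> b)).
    intros b. destruct (nat_cases b) as [->|[c ->]].
    + right. split; [apply ES0|apply succ_zero].
    + rewrite ESS. destruct (IH c) as [[H ->]|[H K]]; [now left|right].
      split; [exact H|]. intros E. now apply K, succ_inj.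
Qed.

(** [rangeF · h] is the characteristic function of the range of [h], if
    [h · k >= k] for all [k]; this bounds the search for a preimage. *)
Definition upto_rangeF : D ((N ~> N) ~> N ~> N ~> N) :=
  eval (econs eqF (enil M)) (lam (lam (lam (Cst (cRec N) $ Zero
    $ lam (lam (Cst (cRec N) $ x1 $ lam (lam One)
        $ (Var (vS (vS (vS (vS (vS v0))))) $ x3 $ (x4 $ x0))))
    $ x0)))).

Definition rangeF : D ((N ~> N) ~> N ~> N) :=
  eval (econs upto_rangeF (enil M)) (lam (lam (x2 $ x1 $ x0 $ Succ x0))).

Lemma upto_range_spec h b k :
  (upto_rangeF · h · b · k = one /\ exists j, lt j k /\ b = h · j)
  \/ (upto_rangeF · h · b · k = zero /\ ~ exists j, lt j k /\ b = h · j).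
Proof.
  assert (E0 : upto_rangeF · h · b · zero = zero).
  { unfold upto_rangeF. ev. apply rec_zero. }
  assert (ES : forall k, upto_rangeF · h · b · succ k
    = cst (cRec N) · (upto_rangeF · h · b · k)
      · eval (enil M) (lam (lam One)) · (eqF · b · (h · k))).
  { intros j. unfold upto_rangeF. ev. rewrite rec_succ. ev. reflexivity. }
  assert (E1 : forall a, cst (cRec N) · a · eval (enil M) (lam (lam One)) · one
    = one).
  { intros a. unfold one at 1. rewrite rec_succ. ev. reflexivity. }
  apply (induction (p :=
    Var (vS upto_rangeF) $ Var (vS h) $ Var (vS b) $ x0 =o One
      /\o Ex N (Ex N (Var (vS (vS (vS addF))) $ Succ x1 $ x0 =o x2)
        /\o Var (vS (vS b)) =o Var (vS (vS h)) $ x0)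
    \/o Var (vS upto_rangeF) $ Var (vS h) $ Var (vS b) $ x0 =o Zero
      /\o Neg (Ex N (Ex N (Var (vS (vS (vS addF))) $ Succ x1 $ x0 =o x2)
        /\o Var (vS (vS b)) =o Var (vS (vS h)) $ x0))) eq_refl).
  - right. split; [exact E0|]. intros [j [H _]]. exact (lt_0_inv H).
  - intros m IH. change (
      (upto_rangeF · h · b · m = one /\ exists j, lt j m /\ b = h · j)
      \/ (upto_rangeF · h · b · m = zero
          /\ ~ exists j, lt j m /\ b = h · j)) in IH.
    change (
      (upto_rangeF · h · b · succ m = one
        /\ exists j, lt j (succ m) /\ b = h · j)
      \/ (upto_rangeF · h · b · succ m = zero
          /\ ~ exists j, lt j (succ m) /\ b = h · j)).
    rewrite ES. destruct (eqF_spec b (h · m)) as [[-> E]|[-> E]].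
    + left. split; [apply E1|]. exists m. split; [apply le_refl|exact E].
    + rewrite rec_zero. destruct IH as [[H (j & Hj & Ej)]|[H K]].
      * left. split; [exact H|]. exists j. split; [|exact Ej].
        apply (lt_le_trans Hj), le_succ_r.
      * right. split; [exact H|]. intros (j & Hj & Ej).
        apply lt_succ_cases in Hj as [Hj| ->]; [|now apply E].
        apply K. now exists j.
Qed.

Lemma range_eq h b : rangeF · h · b = upto_rangeF · h · b · succ b.
Proof. unfold rangeF. ev. reflexivity. Qed.

Lemma le_one_cases n : le n one -> n = zero \/ n = one.
Proof.
  intros H. apply le_cases in H as [H|H]; [now right|left].
  apply le_0_inv. exact (proj1 (le_succ_iff _ _) H).
Qed.

Lemma range_le_one h b : le (rangeF · h · b) one.
Proof.
  rewrite range_eq. destruct (upto_range_spec h b (succ b)) as [[-> _]|[-> _]].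
  - apply le_refl.
  - apply le_0.
Qed.

Lemma range_intro h k : le k (h · k) -> rangeF · h · (h · k) = one.
Proof.
  intros H. rewrite range_eq.
  destruct (upto_range_spec h (h · k) (succ (h · k))) as [[E _]|[_ K]];
    [exact E|]. exfalso. apply K. exists k. split; [|reflexivity].
  now apply le_succ_iff.
Qed.

Lemma range_elim h b : rangeF · h · b = one -> exists k, b = h · k.
Proof.
  rewrite range_eq. intros E.
  destruct (upto_range_spec h b (succ b)) as [[_ (k & _ & H)]|[K _]].
  - now exists k.
  - rewrite K in E. symmetry in E. now apply succ_zero in E.
Qed.

Definition truncF : D ((N ~> N) ~> N ~> N) := eval (enil M)
  (lam (lam (Cst (cRec N) $ Zero $ lam (lam One) $ (x1 $ x0)))).

Lemma trunc_zero g n : g · n = zero -> truncF · g · n = zero.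
Proof. intros E. unfold truncF. ev. rewrite E. apply rec_zero. Qed.

Lemma trunc_succ g n m : g · n = succ m -> truncF · g · n = one.
Proof.
  intros E. unfold truncF. ev. rewrite E, rec_succ. ev. reflexivity.
Qed.

(** [chooseF · G · F · n] searches the sequence [F · n] for some [m] with
    [G · (pairF · n · m) = one]. *)
Definition chooseF : D ((N ~> N) ~> (N ~> Seq N) ~> N ~> N) := eval (enil M)
  (lam (lam (lam (Cst (cLRec N N) $ Zero
    $ lam (lam (Cst (cRec N) $ x1 $ lam (lam x2) $ (x4 $ pair x2 x0)))
    $ (x1 $ x0))))).

(** The fold overwrites its value at each entry that passes the test. The head of a sequence is
    treated last, so the result is the first passing entry as soon as there is one. *)
Lemma choose_spec G F n m : (forall k, le (G · k) one) ->
  mem m (F · n) -> G · (pairF · n · m) = one ->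
  G · (pairF · n · (chooseF · G · F · n)) = one.
Proof.
  intros G1 Hm Em. unfold chooseF. ev. change (eval _ Zero) with zero.
  set (step := eval _ (lam (lam _))).
  assert (S1 : forall a b, G · (pairF · n · b) = one -> step · a · b = b).
  { intros a b E. unfold step. ev. rewrite eval_pair. cbn [eval econs].
    rewrite E. unfold one. rewrite rec_succ. ev. reflexivity. }
  assert (S0 : forall a b, G · (pairF · n · b) = zero -> step · a · b = a).
  { intros a b E. unfold step. ev. rewrite eval_pair. cbn [eval econs].
    rewrite E. apply rec_zero. }
  clearbody step. revert Hm. generalize (F · n). clear F.
  set (r := cst (cLRec N N) · zero · step).
  change (forall l, mem m l -> G · (pairF · n · (r · l)) = one).
  apply (list_induction (p :=
    Ex N (Ex N (Var (vS (vS (vS addF))) $ Succ x1 $ x0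
          =o Var (vS (vS (vS lenF))) $ x2)
      /\o Var (vS (vS nthF)) $ x1 $ x0 =o Var (vS (vS m)))
    ->o Var (vS G) $ (Var (vS pairF) $ Var (vS n) $ (Var (vS r) $ x0)) =o One)
    eq_refl).
  - intros H. exfalso. exact (mem_nil H).
  - intros b k IH.
    change (mem m k -> G · (pairF · n · (r · k)) = one) in IH.
    change (mem m (cons b k) -> G · (pairF · n · (r · cons b k)) = one).
    intros H. unfold r. rewrite lrec_cons. fold r.
    destruct (le_one_cases (G1 (pairF · n · b))) as [E|E].
    + rewrite S0 by exact E. apply IH.
      apply mem_cons in H as [->|H]; [|exact H].
      rewrite Em in E. now apply succ_zero in E.
    + now rewrite S1.
Qed.

(** ** Standard elements *)

Lemma st_zero : st zero.
Proof. exact (st_closed Zero). Qed.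

Lemma st_succ n : st n -> st (succ n).
Proof. apply st_app. exact (st_closed (Cst cSucc)). Qed.

(** The property mentions [St], so this needs external induction, on [n] and uniformly in [m]. *)
Lemma st_le m n : st n -> le m n -> st m.
Proof.
  intros Hn. revert m.
  change (sat (All N (Ex N (Var (vS (vS (vS addF))) $ x1 $ x0 =o x2)
    ->o St x0)) (econs n param)).
  revert n Hn. apply external_induction.
  - change (forall m, le m zero -> st m). intros m H.
    rewrite (le_0_inv H). apply st_zero.
  - intros n Hn IH. change (forall m, le m n -> st m) in IH.
    change (forall m, le m (succ n) -> st m). intros m H.
    destruct (le_cases H) as [->|K]; [now apply st_succ|].
    apply IH. exact (proj1 (le_succ_iff _ _) K).
Qed.

Lemma HAC_pair (G : D (N ~> N)) :
  (forall n, st n -> exists m, st m /\ G · (pairF · n · m) = one) ->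
  exists F, st F /\ forall n, st n ->
    exists m, mem m (F · n) /\ G · (pairF · n · m) = one.
Proof.
  intros H.
  destruct (HM param (ax_HAC (r := N) (t := N) (p := Var (vS (vS G))
    $ (Var (vS (vS pairF)) $ x1 $ x0) =o One) eq_refl) H) as (F & HF & K).
  exists F. split; [exact HF|]. intros n Hn.
  destruct (K n Hn) as (m & Hm & E). exists m. split; [|exact E].
  apply sat_Mem in Hm. exact Hm.
Qed.

(** Idealisation asks for one node that is long enough for all entries of a standard finite sequence
    [x]. The sum of [x] is standard and bounds every entry, so a node of that length will do. *)
Lemma idealisation_tree (A : D (N ~> N)) :
  (forall n, st n -> exists l, A · (codeF · l) = one /\ le n (lenF · l)) ->
  exists l, forall n, st n -> A · (codeF · l) = one /\ le n (lenF · l).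
Proof.
  intros H.
  apply (HM param (ax_I (s := N) (t := Seq N) (p :=
    Var (vS (vS A)) $ (Var (vS (vS codeF)) $ x1) =o One
    /\o Ex N (Var (vS (vS (vS addF))) $ x1 $ x0
      =o Var (vS (vS (vS lenF))) $ x2)) eq_refl)).
  intros x Hx. destruct (H (sumF · x)) as (l & Hl & Kl).
  - apply st_app; [apply st_closed|exact Hx].
  - exists l. intros z Hz. apply sat_Mem in Hz. split; [exact Hl|].
    exact (le_trans (mem_le_sum Hz) Kl).
Qed.

(** * The principles in a model *)

Definition le1 (f : D (N ~> N)) := forall n, le (f · n) one.

Definition approx1 (f g : D (N ~> N)) := forall n, st n -> f · n = g · n.

Definition bin_tree (A : D (N ~> N)) :=
  le1 A
  /\ (forall b, A · b = one -> exists l, codeF · l = b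
        /\ forall i, lt i (lenF · l) -> le (nthF · l · i) one)
  /\ (forall l n, le n (lenF · l) -> A · (codeF · l) = one ->
        A · (codeF · (initF · (nthF · l) · n)) = one).

Definition stp := forall f, le1 f -> exists g, st g /\ le1 g /\ approx1 f g.

Definition stp_tree := forall A, bin_tree A ->
  (forall n, st n -> exists l, lenF · l = n /\ A · (codeF · l) = one) ->
  exists g, st g /\ le1 g
    /\ forall n, st n -> A · (codeF · (initF · g · n)) = one.

Definition stp_fun := forall f, exists g, st g /\
  ((forall n, st n -> st (f · n)) -> approx1 f g).

(** * Truth of the formal principles in the model *)

Lemma sat_Le1 V (e : env M V) f : sat (Le1 f) e <-> le1 (eval e f).
Proof.
  unfold Le1, le1. cbn [sat]. split; intros H n; specialize (H n).
  - apply sat_Le in H. cbn [eval] in H. now rewrite eval_twk in H.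
  - apply sat_Le. cbn [eval]. now rewrite eval_twk.
Qed.

Lemma sat_approx V (e : env M V) f g :
  sat (approx f g) e <-> approx1 (eval e f) (eval e g).
Proof.
  unfold approx, Allst, approx1. cbn [sat].
  split; intros H n Hn; specialize (H n Hn).
  - cbn [eval] in H. now rewrite !eval_twk in H.
  - cbn [eval]. now rewrite !eval_twk.
Qed.

Lemma sat_BinTree V (e : env M V) A : sat (BinTree A) e <-> bin_tree (eval e A).
Proof.
  unfold BinTree, bin_tree, InSet. cbn [sat]. rewrite sat_Le1.
  split; intros (H1 & H2 & H3); (split; [exact H1|split]).
  - intros b Hb. destruct (H2 b) as (l & El & Hl).
    + cbn [eval]. now rewrite eval_twk.
    + exists l. rewrite eval_code in El. split; [exact El|].
      intros i Hi. specialize (Hl i). rewrite sat_Lt, sat_Le in Hl.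
      cbn [eval] in Hl. rewrite eval_len, eval_nthf in Hl. now apply Hl.
  - intros l n Hn Hl. specialize (H3 l n). rewrite sat_Le in H3.
    cbn [eval] in H3. rewrite eval_len, eval_code, eval_bar, eval_nthf in H3.
    rewrite !eval_twk in H3. now apply H3.
  - intros b Hb. cbn [eval] in Hb. rewrite eval_twk in Hb.
    destruct (H2 b Hb) as (l & El & Hl). exists l. rewrite eval_code.
    split; [exact El|]. intros i. rewrite sat_Lt, sat_Le. cbn [eval].
    rewrite eval_len, eval_nthf. apply Hl.
  - intros l n. rewrite sat_Le. cbn [eval].
    rewrite eval_len, eval_code, eval_bar, eval_nthf, !eval_twk.
    intros [Hn Hl]. now apply H3.
Qed.

Lemma sat_HasLength V (e : env M V) b n : sat (HasLength b n) e <->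
  exists l, codeF · l = eval e b /\ lenF · l = eval e n.
Proof.
  unfold HasLength. cbn [sat].
  split; intros (l & H1 & H2); exists l;
    rewrite eval_code, eval_len, !eval_twk in *; now split.
Qed.

Lemma sat_STP : sat STP (enil M) <-> stp.
Proof.
  unfold STP, Exst, stp. cbn [sat].
  split; intros H f Hf.
  - destruct (H f) as (g & Hg & K1 & K2); [now apply sat_Le1|].
    exists g. apply sat_Le1 in K1. apply sat_approx in K2. now split.
  - apply sat_Le1 in Hf. destruct (H f Hf) as (g & Hg & K1 & K2).
    exists g. rewrite sat_Le1, sat_approx. now split.
Qed.

Lemma sat_STP_tree : sat STP_tree (enil M) <-> stp_tree.
Proof.
  unfold STP_tree, Exst, Allst, stp_tree, InSet. cbn [sat].
  split; intros H A HA K.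
  - destruct (H A) as (g & Hg & K1 & K2); [now apply sat_BinTree| |].
    + intros n Hn. destruct (K n Hn) as (l & El & Al).
      exists (codeF · l). rewrite sat_HasLength. split; [|exact Al]. now exists l.
    + exists g. apply sat_Le1 in K1. split; [exact Hg|]. split; [exact K1|].
      intros n Hn. specialize (K2 n Hn). cbn [eval] in K2.
      now rewrite eval_bar in K2.
  - apply sat_BinTree in HA. destruct (H A HA) as (g & Hg & K1 & K2).
    + intros n Hn. destruct (K n Hn) as (b & Hb & Ab).
      apply sat_HasLength in Hb as (l & El & Ll). exists l.
      split; [exact Ll|]. rewrite El. exact Ab.
    + exists g. rewrite sat_Le1. split; [exact Hg|]. split; [exact K1|].
      intros n Hn. cbn [eval]. rewrite eval_bar. exact (K2 n Hn).
Qed.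

Lemma sat_STP_fun : sat STP_fun (enil M) <-> stp_fun.
Proof.
  unfold STP_fun, Exst, Allst, stp_fun. cbn [sat].
  split; intros H f; destruct (H f) as (g & Hg & K); exists g;
    (split; [exact Hg|]).
  - intros L. apply sat_approx in K; [exact K|].
    intros n Hn. exists (f · n). split; [now apply L|reflexivity].
  - intros L. apply sat_approx, K. intros n Hn.
    destruct (L n Hn) as (m & Hm & E). cbn [eval econs] in E. now rewrite E.
Qed.

(* A node of [A] of nonstandard length, read as a function, has a standard
   part by [stp]; that part is the required path. *)
Lemma stp_stp_tree : stp -> stp_tree.
Proof.
  intros H A (_ & A2 & A3) L.
  destruct (@idealisation_tree A) as [l Hl].
  { intros n Hn. destruct (L n Hn) as (l & E & Al). exists l.
    split; [exact Al|]. rewrite E. apply le_refl. }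
  (* Membership of the node does not depend on [n], so one standard instance provides it. *)
  destruct (Hl zero st_zero) as [Al _].
  destruct (A2 _ Al) as (k & E & Bk). apply code_inj in E. subst k.
  destruct (H (nthF · l)) as (g & Hg & G1 & Gl).
  { intros i. destruct (le_or_lt (lenF · l) i) as [K|K]; [|now apply Bk].
    rewrite (nth_ge K). apply le_0. }
  exists g. split; [exact Hg|]. split; [exact G1|]. intros n Hn.
  (* Every index below the standard [n] is standard, so [g] agrees there with the node, and the
     initial segment of [g] is one of the node. *)
  rewrite <- (@init_ext (nthF · l) g n).
  - apply A3; [apply (Hl n Hn)|exact Al].
  - intros i Hi. apply Gl. apply (st_le Hn). now apply lt_le.
Qed.

(* The tree is the set of all initial segments of [f]. *)
Lemma stp_tree_stp : stp_tree -> stp.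
Proof.
  intros H f Hf.
  set (h := eval (econs codeF (econs initF (econs f (enil M))))
    (lam (x1 $ (x2 $ x3 $ x0)))).
  assert (Eh : forall k, h · k = codeF · (initF · f · k)).
  { intros k. unfold h. ev. reflexivity. }
  clearbody h.
  assert (Ah : forall l, rangeF · h · (codeF · l) = one ->
    l = initF · f · (lenF · l)).
  { intros l E. apply range_elim in E as [k E]. rewrite Eh in E.
    apply code_inj in E. subst l. now rewrite len_init. }
  assert (hA : forall k, rangeF · h · (codeF · (initF · f · k)) = one).
  { intros k. rewrite <- Eh. apply range_intro. rewrite Eh.
    rewrite <- (len_init f k) at 1. apply len_le_code. }
  destruct (H (rangeF · h)) as (g & Hg & G1 & K).
  - split; [|split].
    + intros b. apply range_le_one.
    + intros b E. apply range_elim in E as [k ->].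
      exists (initF · f · k). split; [now rewrite Eh|].
      intros i Hi. rewrite len_init in Hi. rewrite (nth_init f Hi). apply Hf.
    + intros l n Hn E. apply Ah in E.
      rewrite (@init_ext (nthF · l) f n); [apply hA|].
      intros i Hi. rewrite E. apply nth_init. exact (lt_le_trans Hi Hn).
  - intros n _. exists (initF · f · n). split; [apply len_init|apply hA].
  - exists g. split; [exact Hg|]. split; [exact G1|]. intros n Hn.
    (* Length n + 1 makes [n] an index of the segment, so the common segment of [f] and [g]
       determines their values at [n]. *)
    assert (E := Ah _ (K (succ n) (st_succ Hn))). rewrite len_init in E.
    rewrite <- (@nth_init f (succ n) n), <- E; [|apply le_refl].
    apply nth_init, le_refl.
Qed.

(* [stp] makes the graph of [f] standard, and HAC recovers a function from
   the standard graph. *)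
Lemma stp_stp_fun : stp -> stp_fun.
Proof.
  intros H f.
  destruct (classic (forall n, st n -> st (f · n))) as [K|K].
  (* If [f] takes a nonstandard value at a standard argument, the implication is vacuous and any
     closed term serves as [g]. *)
  2: { exists (eval (enil M) (default (N ~> N))).
       split; [apply st_closed|contradiction]. }
  (* The graph of [f] is the range of the map sending k to the code of (k, f(k)), which is at least
     k. *)
  set (h := eval (econs pairF (econs f (enil M))) (lam (x1 $ x0 $ (x2 $ x0)))).
  assert (Eh : forall k, h · k = pairF · k · (f · k)).
  { intros k. unfold h. ev. reflexivity. }
  clearbody h.
  destruct (H (rangeF · h)) as (G & HG & G1 & HG').
  { intros b. apply range_le_one. }
  assert (st_pair : forall n m, st n -> st m -> st (pairF · n · m)).
  { intros n m Hn Hm. apply st_app; [|exact Hm].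
    apply st_app; [apply st_closed|exact Hn]. }
  (* [G] agrees with the graph only at standard codes, hence the restriction to standard [n] and
     [m]. *)
  assert (Gf : forall n m, st n -> st m -> G · (pairF · n · m) = one ->
    f · n = m).
  { intros n m Hn Hm E. rewrite <- HG' in E by now apply st_pair.
    apply range_elim in E as [k E]. rewrite Eh in E.
    apply pair_inj in E as [-> ->]. reflexivity. }
  destruct (@HAC_pair G) as (F & HF & KF).
  { intros n Hn. exists (f · n). split; [now apply K|].
    rewrite <- HG' by auto. rewrite <- Eh. apply range_intro.
    rewrite Eh. apply le_pair_l. }
  assert (st_g : st (chooseF · G · F)).
  { apply st_app; [|exact HF]. apply st_app; [apply st_closed|exact HG]. }
  exists (chooseF · G · F). split; [exact st_g|]. intros _ n Hn.
  (* The chosen value is standard because [chooseF] is closed and [G], [F] and [n] are standard;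
     this is what lets [Gf] identify it with the value of [f]. *)
  apply Gf; [exact Hn|now apply st_app|].
  destruct (KF n Hn) as (m & Hm & E). exact (choose_spec G1 Hm E).
Qed.

Lemma stp_fun_stp : stp_fun -> stp.
Proof.
  intros H f Hf. destruct (H f) as (g & Hg & K).
  exists (truncF · g). split; [|split].
  - apply st_app; [apply st_closed|exact Hg].
  - intros n. destruct (nat_cases (g · n)) as [E|[m E]].
    + rewrite (trunc_zero E). apply le_0.
    + rewrite (trunc_succ E). apply le_refl.
  - assert (L : forall n, st n -> st (f · n)).
    { intros n _. apply (st_le (n := one)); [apply st_succ, st_zero|apply Hf]. }
    intros n Hn. assert (E := K L n Hn).
    destruct (le_one_cases (Hf n)) as [F|F]; rewrite F in E; symmetry in E.
    + now rewrite F, (trunc_zero E).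
    + now rewrite F, (trunc_succ E).
Qed.

End Model.

Theorem theorem3p1 :
  P_proves (STP <->o STP_tree) /\ P_proves (STP <->o STP_fun).
Proof.
  split; apply completeness; intros M HM; split; intros H.
  - now apply (sat_STP_tree HM), (stp_stp_tree HM), sat_STP.
  - now apply (sat_STP HM), (stp_tree_stp HM), sat_STP_tree.
  - now apply sat_STP_fun, (stp_stp_fun HM), sat_STP.
  - now apply (sat_STP HM), (stp_fun_stp HM), sat_STP_fun.
Qed.
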